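(* Let $f$ be an error density, $\pi$ a prior distribution and $\{(\mathbf{x}_i,y_i)\}_{i=1}^n$ data indexed by $\omega$, as described in the context, and suppose the following three assumptions hold. (A1) The probability density function $f$ on $\mathbb{R}$ satisfies: $f(y)>0$ and $f(y)=f(|y|)$ for all $y\in\mathbb{R}$; $f(|y_2|)\le f(|y_1|)$ whenever $|y_2|\ge|y_1|$; there is a constant $C>0$ with $f\le C$; and either (i) (regularly varying case) there are constants $C_f>0$ and $\alpha>0$ with $\lim_{y\to\pm\infty} f(y)/\big(C_f|y|^{-(\alpha+1)}\big)=1$, or (ii) (log-regularly varying case) there are constants $C_f>0$ and $\alpha>0$ with $\lim_{y\to\pm\infty} f(y)/\big(C_f|y|^{-1}(\log|y|)^{-(\alpha+1)}\big)=1$. (A2) Under the prior $\pi$ of $(\boldsymbol\beta,\sigma)\in\mathbb{R}^p\times(0,\infty)$, $\boldsymbol\beta$ given $\sigma$ is normal with mean $\mathbf{0}$ and covariance matrix $\sigma^2\mathbf{I}_p$, and $\sigma^2$ has an inverse-gamma distribution with arbitrary shape and scale parameters. (A3) In case (i), $|\mathrm{O}^{\mathsf c}|>\alpha|\mathrm{O}|$; in case (ii), $|\mathrm{O}^{\mathsf c}|\ge|\mathrm{O}|$. Then, as $\omega\to\infty$: (a) $m_\omega(\mathbf{y})\big/\prod_{i\in\mathrm{O}}f(y_i)\to m(\mathbf{y}_{\mathrm{O}^{\mathsf c}})$; (b) for every $\boldsymbol\beta\in\mathbb{R}^p$ and $\sigma>0$, $\pi_\omega(\boldsymbol\beta,\sigma\mid\mathbf{y})\to\pi(\boldsymbol\beta,\sigma\mid\mathbf{y}_{\mathrm{O}^{\mathsf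 c}})$; (c) the posterior distribution $\pi_\omega(\cdot,\cdot\mid\mathbf{y})$ converges in distribution to $\pi(\cdot,\cdot\mid\mathbf{y}_{\mathrm{O}^{\mathsf c}})$.
   Context: Let $n,p\ge1$ be integers and $\mathbf{x}_1,\dots,\mathbf{x}_n\in\mathbb{R}^p$ fixed vectors. Linear regression model: $Y_i=\mathbf{x}_i^T\boldsymbol\beta+\sigma\varepsilon_i$, $i=1,\dots,n$, where $\boldsymbol\beta\in\mathbb{R}^p$, $\sigma>0$, the errors $\varepsilon_1,\dots,\varepsilon_n$ are i.i.d. with density $f$ and independent of $(\boldsymbol\beta,\sigma)$. Data indexed by $\omega>0$: for each $i$, $y_i\in\mathbb{R}$ has a fixed sign (not depending on $\omega$) and $|y_i|=a_i+b_i\omega$, where $a_i>0$ is a constant and $b_i$ is a constant with $b_i=0$ (non-outlier) or $b_i\ge1$ (outlier). Put $\mathbf{y}=(y_1,\dots,y_n)^T$, $\mathrm{O}=\{i:b_i\ge1\}$, $\mathrm{O}^{\mathsf c}=\{1,\dots,n\}\setminus\mathrm{O}$, $\mathbf{y}_{\mathrm{O}^{\mathsf c}}=\{y_i:i\in\mathrm{O}^{\mathsf c}\}$; $|\mathrm{O}|$ and $|\mathrm{O}^{\mathsf c}|$ denote cardinalities. Let $g(\sigma)=\sigma^\alpha$ if $f$ is regularly varying (case (i)) and $g(\sigma)=1$ if $f$ is log-regularly varying (case (ii)). Write $\pi(\boldsymbol\beta,\sigma)$ for the prior density of $(\boldsymbol\beta,\sigma)$. Define $$m_\omega(\mathbf{y})=\int_{\mathbb{R}^p}\int_0^\infty\pi(\boldsymbol\beta,\sigma)\prod_{i=1}^n\frac1\sigma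 f\Big(\frac{y_i-\mathbf{x}_i^T\boldsymbol\beta}{\sigma}\Big)\,d\sigma\,d\boldsymbol\beta,$$ $$m(\mathbf{y}_{\mathrm{O}^{\mathsf c}})=\int_{\mathbb{R}^p}\int_0^\infty\pi(\boldsymbol\beta,\sigma)\,g(\sigma)^{|\mathrm{O}|}\prod_{i\in\mathrm{O}^{\mathsf c}}\frac1\sigma f\Big(\frac{y_i-\mathbf{x}_i^T\boldsymbol\beta}{\sigma}\Big)\,d\sigma\,d\boldsymbol\beta,$$ and, these constants being finite under the hypotheses, the probability densities on $\mathbb{R}^p\times(0,\infty)$ (and the associated distributions, denoted the same way) $$\pi_\omega(\boldsymbol\beta,\sigma\mid\mathbf{y})=\frac{\pi(\boldsymbol\beta,\sigma)\prod_{i=1}^n\frac1\sigma f\big(\frac{y_i-\mathbf{x}_i^T\boldsymbol\beta}{\sigma}\big)}{m_\omega(\mathbf{y})},\qquad \pi(\boldsymbol\beta,\sigma\mid\mathbf{y}_{\mathrm{O}^{\mathsf c}})=\frac{\pi(\boldsymbol\beta,\sigma)\,g(\sigma)^{|\mathrm{O}|}\prod_{i\in\mathrm{O}^{\mathsf c}}\frac1\sigma f\big(\frac{y_i-\mathbf{x}_i^T\boldsymbol\beta}{\sigma}\big)}{m(\mathbf{y}_{\mathrm{O}^{\mathsf c}})}.$$ The inverse-gamma distribution with shape $a>0$ and scale $b>0$ has density proportional to $t^{-a-1}e^{-b/t}$ on $(0,\infty)$. *)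

(* Defs.v *)
From HB Require Import structures.
From mathcomp Require Import all_boot all_order all_algebra.
From mathcomp Require Import all_classical all_reals all_analysis.

Set Implicit Arguments.
Unset Strict Implicit.
Unset Printing Implicit Defensive.

Import Order.TTheory GRing.Theory Num.Theory.
Import numFieldNormedType.Exports.

Local Open Scope classical_set_scope.
Local Open Scope ring_scope.

(* R^p is the type 'cV[R]_p with the topology of the library; its sigma-algebra
   is the one generated by the coordinates, i.e. the Borel sigma-algebra. *)
Definition measure_matrix_display : measure_display -> measure_display.
Proof. exact. Qed.

Section measurable_matrix.
Context {d} {T : sigmaRingType d} (m n : nat).

Definition mx_coord_system : set (set 'M[T]_(m, n)) :=
  \bigcup_(ij in [set: 'I_m * 'I_n])
    preimage_set_system setT (fun M : 'M[T]_(m, n) => M ij.1 ij.2) measurable.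

Let mx_set0 : <<s mx_coord_system >> set0.
Proof. exact: sigma_algebra0. Qed.

Let mx_setC A : <<s mx_coord_system >> A -> <<s mx_coord_system >> (~` A).
Proof. exact: sigma_algebraC. Qed.

Let mx_bigcup (F : _^nat) : (forall i, <<s mx_coord_system >> (F i)) ->
  <<s mx_coord_system >> (\bigcup_i (F i)).
Proof. exact: sigma_algebra_bigcup. Qed.

HB.instance Definition _ := @isMeasurable.Build (measure_matrix_display d)
  'M[T]_(m, n) <<s mx_coord_system >> mx_set0 mx_setC mx_bigcup.

Lemma measurable_mx_coord (i : 'I_m) (j : 'I_n) :
  measurable_fun [set: 'M[T]_(m, n)] (fun M => M i j).
Proof.
move=> _ Y mY; rewrite setTI; apply: sub_sigma_algebra.
by exists (i, j) => //; exists Y => //; rewrite setTI.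
Qed.

End measurable_matrix.

Lemma measurable_fun_mxP d d' (T : sigmaRingType d) (U : measurableType d')
    m n (f : U -> 'M[T]_(m, n)) :
  (forall i j, measurable_fun [set: U] (fun x => f x i j)) ->
  measurable_fun [set: U] f.
Proof.
move=> mf; apply: (@measurability _ _ _ _ _ _ (@mx_coord_system d T m n)) => //.
move=> _ [B [[i j] _ [Y mY <-]] <-]; rewrite setTI.
have /= := mf i j measurableT Y mY; rewrite !setTI.
by rewrite comp_preimage.
Qed.

Section vec_lebesgue.
Variable R : realType.

Definition cV_cons n (tb : measurableTypeR R * 'cV[R]_n) : 'cV[R]_(1 + n) :=
  col_mx (tb.1 : R)%:M tb.2.

Definition cV_uncons n (v : 'cV[R]_(1 + n)) : measurableTypeR R * 'cV[R]_n :=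
  (v ord0 ord0, dsubmx v).

(* Lebesgue measure on R^n, as the n-fold product of Lebesgue measure on R. *)
Fixpoint vec_lebesgue (n : nat) : set 'cV[R]_n -> \bar R :=
  match n with
  | 0 => \d_ (0 : 'cV[R]_0)
  | n'.+1 => pushforward
      (product_measure1 (@lebesgue_measure R) (@vec_lebesgue n'))
      (@cV_cons n')
  end.

Lemma cV_consK n : cancel (@cV_cons n) (@cV_uncons n).
Proof.
move=> [t b]; rewrite /cV_uncons /cV_cons /= col_mxKd; congr pair.
have -> : ord0 = lshift n (ord0 : 'I_1) by exact/val_inj.
by rewrite col_mxEu mxE eqxx.
Qed.

Lemma measurable_cV_cons n :
  measurable_fun [set: measurableTypeR R * 'cV[R]_n] (@cV_cons n).
Proof.
apply: measurable_fun_mxP => i j; rewrite /cV_cons.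
case: (splitP i) => k ik.
  have -> : i = lshift n k by exact/val_inj.
  rewrite (_ : (fun _ => _) = fst) //; apply/funext => x.
  by rewrite col_mxEu mxE !ord1 eqxx.
have -> : i = rshift 1 k by exact/val_inj.
rewrite (_ : (fun _ => _) = (fun M : 'cV[R]_n => M k j) \o snd); last first.
  by apply/funext => x /=; rewrite col_mxEd.
by apply: measurableT_comp => //; exact: measurable_mx_coord.
Qed.

Lemma measurable_cV_uncons n :
  measurable_fun [set: 'cV[R]_(1 + n)] (@cV_uncons n).
Proof.
apply/measurable_fun_pairP; split; first exact: measurable_mx_coord.
apply: measurable_fun_mxP => i j /=.
rewrite (_ : (fun _ => _) = fun x : 'cV[R]_(1 + n) => x (rshift 1 i) j).
  exact: measurable_mx_coord.
by apply/funext => x; rewrite mxE.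
Qed.

Lemma vec_lebesgue_measure n :
  exists mu : {sigma_finite_measure set 'cV[R]_n -> \bar R},
    @vec_lebesgue n = mu :> (set 'cV[R]_n -> \bar R).
Proof.
elim: n => [|n [mu mE]] /=; first by exists (\d_ (0 : 'cV[R]_0)).
rewrite mE.
pose pr : {measure set (measurableTypeR R * 'cV[R]_n)%type -> \bar R} :=
  product_measure1 (@lebesgue_measure R) mu.
have prsf : sigma_finite setT pr.
  have /sigma_finiteP[F [TF ndF Foo]] := sigma_finiteT (@lebesgue_measure R).
  have /sigma_finiteP[G [TG ndG Goo]] := sigma_finiteT mu.
  exists (fun k => F k `*` G k).
    rewrite -setXTT TF TG predeqE => -[x y]; split; last first.
      by move=> [k _ []/= ? ?]; split; exists k.
    move=> [/= [k _ Fkx] [l _ Gly]]; exists (maxn k l) => //; split.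
    - by move: x Fkx; exact/subsetPset/ndF/leq_maxl.
    - by move: y Gly; exact/subsetPset/ndG/leq_maxr.
  move=> k; have [? ?] := Foo k; have [? ?] := Goo k.
  split; first exact: measurableX.
  by rewrite /pr /= product_measure1E// lte_mul_pinfty// ge0_fin_numE.
have sf : sigma_finite setT (pushforward pr (@cV_cons n)).
  have [F FT mF] := prsf.
  exists (fun k => @cV_uncons n @^-1` F k); first by rewrite -preimage_bigcup -FT.
  move=> k; have [mFk Fk] := mF k; split.
    by rewrite -[X in measurable X]setTI; exact: measurable_cV_uncons.
  rewrite /pushforward -comp_preimage (_ : _ \o _ = id) ?preimage_id//.
  by apply/funext => x /=; rewrite cV_consK.
pose q : {sigma_finite_measure set 'cV[R]_(1 + n) -> \bar R} :=
  HB.pack (pushforward pr (@cV_cons n))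
    (Measure_isSigmaFinite.Build _ _ _ (pushforward pr (@cV_cons n)) sf).
have mc := @measurable_cV_cons n.
by exists (q mc mc mc).
Qed.

Let vec0 n : @vec_lebesgue n set0 = 0%E.
Proof. by have [mu ->] := vec_lebesgue_measure n; rewrite measure0. Qed.

Let vec_ge0 n A : (0 <= @vec_lebesgue n A)%E.
Proof. by have [mu ->] := vec_lebesgue_measure n; exact: measure_ge0. Qed.

Let vec_sigma_additive n : semi_sigma_additive (@vec_lebesgue n).
Proof.
by have [mu ->] := vec_lebesgue_measure n; exact: measure_semi_sigma_additive.
Qed.

HB.instance Definition _ n := isMeasure.Build _ _ _ (@vec_lebesgue n)
  (@vec0 n) (@vec_ge0 n) (@vec_sigma_additive n).

Let vec_sigma_finite n : sigma_finite setT (@vec_lebesgue n).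
Proof. by have [mu ->] := vec_lebesgue_measure n; exact: sigma_finiteT. Qed.

HB.instance Definition _ n := Measure_isSigmaFinite.Build _ _ _
  (@vec_lebesgue n) (@vec_sigma_finite n).

End vec_lebesgue.

Section model.
Variable R : realType.
Implicit Types (f : R -> R) (alpha : R) (sigma omega : R).

Inductive tail_case := RegularlyVarying | LogRegularlyVarying.

(* |y|^-(alpha+1), resp. |y|^-1 (log |y|)^-(alpha+1); only the values for large
   |y| matter, so the conventions of ln and `^ for |y| <= 1 play no role. *)
Definition tail_profile (c : tail_case) alpha (y : R) : R :=
  match c with
  | RegularlyVarying => `|y| `^ (- (alpha + 1))
  | LogRegularlyVarying => `|y|^-1 * ln `|y| `^ (- (alpha + 1))
  end.

Record error_density (c : tail_case) alpha f : Prop := ErrorDensity {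
  error_measurable : measurable_fun setT f ;
  error_integral1 : (\int[lebesgue_measure]_y (f y)%:E = 1)%E ;
  error_gt0 : forall y, 0 < f y ;
  error_even : forall y, f y = f `|y| ;
  error_monotone : forall y1 y2 : R, `|y1| <= `|y2| -> f `|y2| <= f `|y1| ;
  error_bounded : exists2 C : R, 0 < C & forall y, f y <= C ;
  error_tail : exists2 Cf : R, 0 < Cf &
    (f y / (Cf * tail_profile c alpha y) @[y --> +oo] --> (1 : R)) /\
    (f y / (Cf * tail_profile c alpha y) @[y --> -oo] --> (1 : R))
}.

(* N(mu, Sigma), for an invertible covariance matrix Sigma. *)
Definition mvnormal_pdf p (mu : 'cV[R]_p) (Sigma : 'M[R]_p) (b : 'cV[R]_p) : R :=
  (Num.sqrt ((2 * pi) ^+ p * \det Sigma))^-1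
  * expR (- (((b - mu)^T *m invmx Sigma *m (b - mu)) ord0 ord0) / 2).

Definition invgamma_kernel (shape scale t : R) : R :=
  t `^ (- shape - 1) * expR (- scale / t).

Definition invgamma_pdf (shape scale t : R) : R :=
  invgamma_kernel shape scale t
  / fine (\int[lebesgue_measure]_(u in `]0%R, +oo[)
            (invgamma_kernel shape scale u)%:E)%E.

(* q is a density, on (0, +oo), of the marginal law of sigma; the equality of
   set functions says that sigma^2 is inverse-gamma distributed. *)
Definition conjugate_prior p (prior : 'cV[R]_p -> R -> R) : Prop :=
  exists (shape scale : R) (q : R -> R),
  [/\ 0 < shape /\ 0 < scale,
      measurable_fun (`]0, +oo[ : set R) q /\ (forall sigma, 0 < sigma -> 0 <= q sigma),
      forall B : set R, measurable B ->
        (\int[lebesgue_measure]_(s in `]0%R, +oo[ `&` [set s | B (s ^+ 2)%R]) (q s)%:E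
         = \int[lebesgue_measure]_(t in `]0%R, +oo[ `&` B)
             (invgamma_pdf shape scale t)%:E)%E
    & forall beta sigma, 0 < sigma ->
        prior beta sigma = mvnormal_pdf 0 (sigma ^+ 2)%:M beta * q sigma].

(* y_i = +/- (a_i + b_i omega), the sign being negative iff s i. *)
Definition response n (s : 'I_n -> bool) (a b : 'I_n -> R) omega (i : 'I_n) : R :=
  (-1) ^+ (s i) * (a i + b i * omega).

Definition outliers n (b : 'I_n -> R) : {set 'I_n} := [set i | 1 <= b i]%SET.

Definition likelihood n p f (x : 'I_n -> 'cV[R]_p) (y : 'I_n -> R)
    (I : {set 'I_n}) (beta : 'cV[R]_p) sigma : R :=
  \prod_(i in I)
    (sigma^-1 * f ((y i - ((x i)^T *m beta) ord0 ord0) / sigma)).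

Definition outlier_weight (c : tail_case) alpha sigma : R :=
  match c with
  | RegularlyVarying => sigma `^ alpha
  | LogRegularlyVarying => 1
  end.

Definition full_joint n p f (prior : 'cV[R]_p -> R -> R)
    (x : 'I_n -> 'cV[R]_p) (y : 'I_n -> R) (beta : 'cV[R]_p) sigma : R :=
  prior beta sigma * likelihood f x y [set: 'I_n]%SET beta sigma.

Definition robust_joint n p (c : tail_case) alpha f (prior : 'cV[R]_p -> R -> R)
    (x : 'I_n -> 'cV[R]_p) (y : 'I_n -> R) (O : {set 'I_n})
    (beta : 'cV[R]_p) sigma : R :=
  prior beta sigma * outlier_weight c alpha sigma ^+ #|O|
  * likelihood f x y (~: O)%SET beta sigma.

Definition marginal p (k : 'cV[R]_p -> R -> R) : \bar R :=
  (\int[@vec_lebesgue R p]_beta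
     \int[lebesgue_measure]_(sigma in `]0%R, +oo[) (k beta sigma)%:E)%E.

(* k normalized; meaningful when 0 < marginal k < +oo. *)
Definition posterior p (k : 'cV[R]_p -> R -> R) (beta : 'cV[R]_p) sigma : R :=
  k beta sigma / fine (marginal k).

(* The parameter space R^p x (0, +oo), inside R^p x R. *)
Definition parameters p : set ('cV[R]_p * R) := [set bs | 0 < bs.2].

(* k is a density with respect to Lebesgue measure on R^p x (0, +oo); in
   particular P does not charge the complement of [parameters]. *)
Definition has_density p (P : probability ('cV[R]_p * R)%type R)
    (k : 'cV[R]_p -> R -> R) : Prop :=
  forall A : set ('cV[R]_p * R), measurable A ->
    P A = marginal (fun beta sigma => k beta sigma * \1_A (beta, sigma)).

(* Weak convergence on the space R^p x (0, +oo): the test functions are bounded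
   and continuous there, with no condition at or across sigma = 0. *)
Definition cvg_in_distribution p (P : R -> probability ('cV[R]_p * R)%type R)
    (Q : probability ('cV[R]_p * R)%type R) : Prop :=
  forall h : 'cV[R]_p * R -> R,
    {within @parameters p, continuous h} ->
    (exists M : R, forall bs, @parameters p bs -> `|h bs| <= M) ->
    (\int[P omega]_(bs in @parameters p) (h bs)%:E @[omega --> +oo%R]
       --> \int[Q]_(bs in @parameters p) (h bs)%:E)%E.

End model.

(* Main.v *)
(* Write u = beta / sigma, a standard Gaussian vector under the prior.  For an
   outlier, Potter's bound gives
     sigma^-1 f(y / sigma - x^T u) / f(y) <= K w(sigma) (1 + |x^T u|)^m
   uniformly in |y| >= a, where w(sigma) = sigma^alpha in the regularly varying
   case and w(sigma) = (1 + sigma)^e, with e as small as one likes, in the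
   log-regularly varying one; each non-outlier contributes at most C / sigma.
   Hence the joint density divided by prod_O f(y_i) is dominated, uniformly in
   omega, by a Gaussian in beta times q(sigma) (sigma^-r1 + sigma^-r2) with
   r1, r2 >= 0, which is integrable because the inverse-gamma law has all its
   negative moments.  Dominated convergence, applied also with a bounded
   continuous test function, then yields the three limits. *)

From HB Require Import structures.
Require Import Defs.
From mathcomp Require Import all_boot all_order all_algebra.
From mathcomp Require Import all_classical all_reals all_analysis.
From mathcomp Require Import measurable_realfun.
From mathcomp Require Import ring lra.

Import Order.TTheory GRing.Theory Num.Theory.
Import numFieldNormedType.Exports.

Set Implicit Arguments.
Unset Strict Implicit.
Unset Printing Implicit Defensive.

Local Open Scope classical_set_scope.
Local Open Scope ring_scope.

(** * Tail comparison for regularly and log-regularly varying densities *)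

(** The inverse-gamma shape is arbitrary, so [sigma] has positive moments only below twice the
    shape, and the dominating function can afford no growth at [sigma = +oo]. This is where (A3)
    enters: the inlier factors [1 / sigma] must pay for the outlier weights. In the regularly
    varying case the net power of [sigma] is [alpha #|O| - #|~: O|], which is negative. In the
    log-regularly varying case [e] is taken to be [1 / n], so that all outliers together cost at
    most [1 + sigma], and a single inlier pays for that. The other obstacle is the shift [x^T u].
    When it is comparable to [y / sigma], the numerator can be as large as [f 0] while [f y] is
    tiny; but then [|y|] is at most of order [sigma |x^T u|], and the loss is polynomial in [|u|].
    Because the prior covariance is proportional to [sigma ^+ 2], this polynomial is integrated
    against a law of [u] that does not involve [sigma]. *)

Section tails.
Variable R : realType.
Implicit Types (c : tail_case) (alpha e t s u v z : R) (f : R -> R).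

(** [z^-1 * slow_part c alpha z] is a global substitute for [tail_profile]: with [1 + ln (1 + z)] in
    place of [ln z] it is positive and monotone on all of (0, +oo), and it stays comparable at
    infinity. *)
Definition slow_part c alpha z : R :=
  match c with
  | RegularlyVarying => z `^ (- alpha)
  | LogRegularlyVarying => (1 + ln (1 + z)) `^ (- (alpha + 1))
  end.

Definition potter_exponent c alpha e : R :=
  match c with RegularlyVarying => alpha | LogRegularlyVarying => e end.

(** In the logarithmic case the base is [1 + s], not [s]: the ratio of the slow parts at [t / s] and
    [t] tends to 1 as [t] grows, so no bound uniform in [t] can vanish with [s]. *)
Definition potter_weight c alpha e s : R :=
  match c with
  | RegularlyVarying => s `^ alpha
  | LogRegularlyVarying => (1 + s) `^ e
  end.

Lemma powRN_le r u v : 0 <= r -> 0 < u -> u <= v -> v `^ (- r) <= u `^ (- r).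
Proof.
move=> r0 u0 uv; rewrite !powRN lef_pV2 ?posrE ?powR_gt0//; last first.
  exact: lt_le_trans uv.
by rewrite ge0_ler_powR// nnegrE; lra.
Qed.

Lemma ln1D_ge0 z : 0 <= z -> 0 <= ln (1 + z).
Proof. by move=> z0; apply: ln_ge0; lra. Qed.

Lemma slow_part_gt0 c alpha z : 0 < z -> 0 < slow_part c alpha z.
Proof.
move=> z0; case: c => /=; apply: powR_gt0 => //.
by have := ln1D_ge0 (ltW z0); lra.
Qed.

Lemma slow_part_le c alpha u v : 0 < alpha -> 0 < u -> u <= v ->
  slow_part c alpha v <= slow_part c alpha u.
Proof.
move=> al0 u0 uv; case: c => /=; apply: powRN_le => //; try lra.
  by have := ln1D_ge0 (ltW u0); lra.
by rewrite lerD2l ler_ln ?posrE; lra.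
Qed.

Lemma ln1D_le e s : 0 < e -> 0 <= s -> 1 + ln (1 + s) <= (1 + e^-1) * (1 + s) `^ e.
Proof.
move=> e0 s0; have s1 : 1 <= 1 + s by lra.
have p1 : 1 <= (1 + s) `^ e.
  by rewrite -[leLHS](powRr0 (1 + s)); apply: ler_powR => //; exact: ltW.
have : ln ((1 + s) `^ e) <= (1 + s) `^ e by apply/ltW/ln_sublinear; lra.
rewrite ln_powR mulrC -ler_pdivlMr// => h; rewrite mulrDl mul1r.
by apply: lerD => //; rewrite mulrC.
Qed.

(** In the regularly varying case this is an identity. In the other,
    [1 + t <= (1 + s) * (1 + t / s)] makes [1 + ln (1 + t)] at most the product of [1 + ln (1 + s)]
    and [1 + ln (1 + t / s)], and the first factor is below a multiple of any small power of
    [1 + s]. *)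
Lemma slow_part_div c alpha e : 0 < alpha -> 0 < e ->
  exists2 K : R, 0 < K & forall t s, 0 < t -> 0 < s ->
  slow_part c alpha (t / s) <= K * potter_weight c alpha e s * slow_part c alpha t.
Proof.
move=> al0 e0; case: c => /=.
  exists 1 => // t s t0 s0; rewrite powRM ?invr_ge0 ?(ltW t0) ?(ltW s0)//.
  rewrite -(powR_inv1 (ltW s0)) -powRrM mulN1r opprK mul1r. rewrite mulrC.
  exact: lexx.
have a0 : 0 < alpha + 1 by lra.
have d0 : 0 < e / (alpha + 1) by rewrite divr_gt0.
(* The logarithm is bounded by a [d]-th power, so that the outer exponent [alpha + 1] yields exactly
   the power [e]. *)
set d := e / (alpha + 1) in d0.
have dv0 : 0 < d^-1 by rewrite invr_gt0.
exists ((1 + d^-1) `^ (alpha + 1)) => [|t s t0 s0]; first by apply: powR_gt0; lra.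
have ts0 : 0 < t / s by rewrite divr_gt0.
have ht := ln1D_ge0 (ltW t0); have hs := ln1D_ge0 (ltW s0).
have hts := ln1D_ge0 (ltW ts0).
have lt : 1 + ln (1 + t) <= (1 + ln (1 + s)) * (1 + ln (1 + t / s)).
  have : ln (1 + t) <= ln (1 + s) + ln (1 + t / s).
    have s1 : 0 < 1 + s by lra.
    have ts1 : 0 < 1 + t / s by lra.
    rewrite -lnM ?posrE// ler_ln ?posrE ?mulr_gt0//; last by lra.
    have -> : (1 + s) * (1 + t / s) = 1 + s + t / s + t by field; rewrite gt_eqF.
    by lra.
  by move=> ?; nra.
have q : 0 < 1 + ln (1 + s) by lra.
have q' : 0 < 1 + ln (1 + t / s) by lra.
rewrite 2![_ `^ (- _)]powRN -ler_pdivrMr ?invr_gt0 ?powR_gt0//; last by lra.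
rewrite invrK mulrC ler_pdivrMr ?powR_gt0//.
have -> : (1 + s) `^ e = ((1 + s) `^ d) `^ (alpha + 1).
  by rewrite -powRrM divfK// gt_eqF.
rewrite -!powRM ?powR_ge0//; try lra; last by apply: mulr_ge0; [lra|exact: powR_ge0].
rewrite ge0_ler_powR ?nnegrE; try lra.
  by rewrite mulr_ge0 ?mulr_ge0 ?powR_ge0; lra.
apply: (le_trans lt); apply: ler_wpM2r; first lra.
by apply: ln1D_le => //; exact: ltW.
Qed.

Lemma near_tail_profile c alpha : 0 < alpha ->
  exists2 K : R, 0 < K & \forall z \near +oo,
    [/\ 0 < tail_profile c alpha z,
        tail_profile c alpha z <= K * (z^-1 * slow_part c alpha z)
      & z^-1 * slow_part c alpha z <= tail_profile c alpha z].
Proof.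
move=> al0; case: c => /=.
  exists 1 => //; near=> z; have z0 : 0 < z by near: z; exact: nbhs_pinfty_gt.
  rewrite gtr0_norm// mul1r powR_gt0//.
  suff -> : z `^ (- (alpha + 1)) = z^-1 * z `^ (- alpha) by [].
  have -> : - (alpha + 1) = -1 - alpha by ring.
  by rewrite -(powR_inv1 (ltW z0)) -powRD ?(gt_eqF z0) ?implybT//.
(* The 3 comes from [1 < ln z] and [1 + z <= z * z], valid once [z] exceeds 2 and [expR 1]: then
   [1 + ln (1 + z) <= 3 * ln z]. *)
exists (3 `^ (alpha + 1)); first by rewrite powR_gt0.
near=> z; have z2 : 2 < z by near: z; exact: nbhs_pinfty_gt.
have ze : expR 1 < z by near: z; exact: nbhs_pinfty_gt.
have z0 : 0 < z by lra.
have l1 : 1 < ln z by rewrite -[ltLHS]expRK ltr_ln ?posrE ?expR_gt0.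
rewrite gtr0_norm//.
have le1 : ln z <= 1 + ln (1 + z).
  by rewrite -[leLHS]add0r lerD// ler_ln ?posrE; lra.
have le2 : 1 + ln (1 + z) <= 3 * ln z.
  have : ln (1 + z) <= ln (z * z) by rewrite ler_ln ?posrE; nra.
  by rewrite lnM ?posrE//; lra.
split.
- by rewrite mulr_gt0 ?invr_gt0// powR_gt0; lra.
- have l0 : 0 < 1 + ln (1 + z) by lra.
  rewrite mulrCA ler_pM2l ?invr_gt0// 2![_ `^ (- _)]powRN.
  rewrite ler_pdivlMr ?powR_gt0// mulrC ler_pdivrMr ?powR_gt0//; last by lra.
  by rewrite -powRM ?ge0_ler_powR ?nnegrE; lra.
- by rewrite ler_pM2l ?invr_gt0// powRN_le; lra.
Unshelve. all: by end_near. Qed.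
End tails.

(** * Potter's bound and the shifted outlier ratio *)

Section potter.
Variables (R : realType) (c : tail_case) (alpha : R) (f : R -> R).
Hypotheses (alpha_gt0 : 0 < alpha) (fE : error_density c alpha f).
Implicit Types (a e t s u v z : R).

Let psi z := z^-1 * slow_part c alpha z.

Let f_gt0 z : 0 < f z. Proof. exact: error_gt0 fE _. Qed.

Let f_le u v : `|u| <= `|v| -> f v <= f u.
Proof.
by move=> uv; rewrite (error_even fE v) (error_even fE u) (error_monotone fE).
Qed.

Let psi_gt0 z : 0 < z -> 0 < psi z.
Proof. by move=> z0; rewrite mulr_gt0 ?invr_gt0// slow_part_gt0. Qed.

Let psi_le u v : 0 < u -> u <= v -> psi v <= psi u.
Proof.
move=> u0 uv; have v0 := lt_le_trans u0 uv.
apply: ler_pM; rewrite ?invr_ge0 ?lef_pV2 ?posrE//.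
- exact: ltW.
- exact/ltW/slow_part_gt0.
- exact: slow_part_le.
Qed.

Let f_psi_near : exists k1 k2 Z : R, [/\ 0 < k1, 0 < k2, 0 < Z &
  forall z, Z <= z -> k1 * psi z <= f z /\ f z <= k2 * psi z].
Proof.
have [Cf Cf0 [fy _]] := error_tail fE.
have [K K0 tK] := near_tail_profile c alpha_gt0.
have : \forall z \near +oo, 2^-1 < f z / (Cf * tail_profile c alpha z) < 2.
  near=> z; apply/andP; split; near: z.
    by apply: (cvgr_gt _ fy); lra.
  by apply: (cvgr_lt _ fy); lra.
move=> /(filterI tK) /(filterI (nbhs_pinfty_gt (num_real (0 : R)))).
move=> [Z [_ hZ]].
exists (Cf / 2), (Cf * 2 * K), (`|Z| + 1); split; rewrite ?divr_gt0 ?mulr_gt0 ?ltr_wpDl//.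
move=> z Zz; have /hZ[z0 [[t0 t1 t2] /andP[h1 h2]]] : Z < z.
  by apply: lt_le_trans Zz; rewrite ltr_pwDr// ler_norm.
have ct0 : 0 < Cf * tail_profile c alpha z by rewrite mulr_gt0.
move: h1 h2; rewrite ltr_pdivlMr// ltr_pdivrMr// => h1 h2; rewrite /psi; split.
  apply: le_trans (ltW h1); rewrite mulrAC [leLHS]mulrC ler_pM2l// ler_pM2l//.
apply: (le_trans (ltW h2)); rewrite mulrCA -!mulrA ler_pM2l// ler_pM2l//.
Unshelve. all: by end_near. Qed.

(** Below the threshold [Z] the bound [C] on [f] suffices, because [psi] is at least [psi Z] there;
    hence the estimate reaches down to 0. *)
Let f_le_psi : exists2 K : R, 0 < K & forall z, 0 < z -> f z <= K * psi z.
Proof.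
have [k1 [k2 [Z [k10 k20 Z0 fZ]]]] := f_psi_near.
have [C C0 fC] := error_bounded fE.
exists (k2 + C / psi Z) => [|z z0].
  by rewrite addr_gt0 ?divr_gt0 ?psi_gt0.
rewrite mulrDl; have [Zz|zZ] := leP Z z.
  apply: (le_trans (fZ _ Zz).2); rewrite lerDl; apply: mulr_ge0 (ltW (psi_gt0 z0)).
  exact: divr_ge0 (ltW C0) (ltW (psi_gt0 Z0)).
have p0 := psi_gt0 z0; apply: (le_trans (fC z)); rewrite -[leLHS]add0r.
apply: lerD; first by rewrite mulr_ge0 ?ltW.
rewrite -mulrA ler_peMr ?(ltW C0)// mulrC ler_pdivlMr ?mul1r ?psi_gt0//.
exact/psi_le/ltW.
Qed.

(** The cut-off [a] is unavoidable, since [psi] blows up at 0 while [f] is bounded. Between [a] and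
    [Z], monotonicity reduces the comparison to [psi a] and [f Z]. *)
Let psi_le_f a : 0 < a ->
  exists2 K : R, 0 < K & forall z, a <= z -> psi z <= K * f z.
Proof.
move=> a0; have [k1 [k2 [Z [k10 k20 Z0 fZ]]]] := f_psi_near.
exists (k1^-1 + psi a / f Z) => [|z az].
  by rewrite addr_gt0 ?divr_gt0 ?psi_gt0 ?invr_gt0.
have z0 := lt_le_trans a0 az.
rewrite mulrDl; have [Zz|zZ] := leP Z z.
  rewrite -[leLHS]addr0 lerD//.
    by rewrite ler_pdivlMl//; exact: (fZ _ Zz).1.
  by apply: mulr_ge0 (ltW (f_gt0 z)); apply: divr_ge0 (ltW _) (ltW (f_gt0 _));
      exact: psi_gt0.
rewrite -[leLHS]add0r; apply: lerD; first by rewrite mulr_ge0 ?invr_ge0 ?ltW.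
apply: (le_trans (psi_le a0 az)).
rewrite -mulrA ler_peMr ?(ltW (psi_gt0 a0))// mulrC ler_pdivlMr ?mul1r//.
by apply: f_le; rewrite !gtr0_norm// ltW.
Qed.

(* Potter's bound; in the log-regularly varying case the logarithmic factor is
   absorbed into an arbitrarily small power [e]. *)
Lemma potter_bound a e : 0 < a -> 0 < e ->
  exists2 K : R, 0 < K & forall t s, a <= t -> 0 < s ->
    f (t / s) <= K * (s * potter_weight c alpha e s) * f t.
Proof.
move=> a0 e0.
have [K1 K10 h1] := f_le_psi; have [K2 K20 h2] := psi_le_f a0.
have [K3 K30 h3] := slow_part_div c alpha_gt0 e0.
exists (K1 * K3 * K2) => [|t s at_ s0]; first by rewrite !mulr_gt0.
have t0 := lt_le_trans a0 at_.
have w0 : 0 < potter_weight c alpha e s.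
  by case: (c) => /=; rewrite powR_gt0// addr_gt0.
apply: (le_trans (h1 _ (divr_gt0 t0 s0))).
rewrite -!mulrA ler_pM2l// /psi invf_div.
have -> : K3 * (K2 * (s * (potter_weight c alpha e s * f t))) =
  s * K3 * potter_weight c alpha e s * (K2 * f t) by ring.
apply: (@le_trans _ _ (s * K3 * potter_weight c alpha e s * psi t)).
  rewrite /psi.
  have -> : s * K3 * potter_weight c alpha e s * (t^-1 * slow_part c alpha t) =
    s / t * (K3 * potter_weight c alpha e s * slow_part c alpha t) by ring.
  by rewrite ler_pM2l ?divr_gt0//; exact: h3.
by rewrite ler_pM2l ?mulr_gt0//; exact: h2.
Qed.

Lemma potter_weightM e u v : 0 < e -> 0 <= u -> 0 <= v ->
  potter_weight c alpha e (u * v) <=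
  (1 + u) `^ potter_exponent c alpha e * potter_weight c alpha e v.
Proof.
move=> e0 u0 v0; have uv := mulr_ge0 u0 v0.
have u1 : 0 <= 1 + u by lra.
have v1 : 0 <= 1 + v by lra.
by case: (c) => /=; rewrite -powRM// ge0_ler_powR ?nnegrE ?mulr_ge0 ?(ltW
    alpha_gt0)//; lra.
Qed.

Lemma potter_weight_le e u v : 0 < e -> 0 <= u -> u <= v ->
  potter_weight c alpha e u <= potter_weight c alpha e v.
Proof.
by move=> e0 u0 uv; case: (c) => /=; rewrite ge0_ler_powR ?nnegrE ?(ltW alpha_gt0)//; lra.
Qed.

Lemma potter_weight_ge0 e u : 0 <= potter_weight c alpha e u.
Proof. by case: (c) => /=; exact: powR_ge0. Qed.

Lemma outlier_ratio_bound a e : 0 < a -> 0 < e ->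
  exists (K : R) (m : nat), 0 < K /\ forall t s v, a <= t -> 0 < s ->
    s^-1 * f (t / s - v)
    <= K * potter_weight c alpha e s * (1 + `|v|) ^+ m * f t.
Proof.
move=> a0 e0; have [K K0 hK] := potter_bound a0 e0.
pose d := potter_exponent c alpha e; pose w := potter_weight c alpha e.
have d0 : 0 <= d by rewrite /d; case: (c) => /=; exact: ltW.
(* The degree [m] must cover one power of [|v|] coming from the linear factor of Potter's bound and
   [d] more coming from its weight. *)
have [m dm] : exists m : nat, 1 + d <= m%:R.
  exists (Num.truncn d).+2.
  by rewrite -natr1 addrC lerD2r; apply/ltW; rewrite truncnS_gt.
(* [A] serves small shifts: there [f (t / s - v) <= f (t / (2 * s))], so [s] is replaced by [2 * s]
   and the weight costs [(1 + 2) ^ d]. [B] serves large shifts, where the numerator is only bounded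
   by [f 0]. *)
pose A := K * 2 * 3 `^ d; pose B := K * (f 0 / f a) * (1 + 2 / a) `^ (1 + d).
exists (A + B), m; split.
  by rewrite addr_gt0 ?mulr_gt0 ?invr_gt0 ?powR_gt0 ?addr_gt0 ?divr_gt0.
move=> t s v at_ s0; have t0 := lt_le_trans a0 at_.
have A0 : 0 <= A by rewrite !mulr_ge0 ?powR_ge0 ?ltW.
have B0 : 0 <= B by rewrite !mulr_ge0 ?powR_ge0 ?invr_ge0 ?ltW.
have w0 : 0 <= w s := potter_weight_ge0 e s.
have vm : 1 <= (1 + `|v|) ^+ m by rewrite exprn_ege1// lerDl.
(* Either the shift [v] is negligible with respect to [t / s], or [t <= 2 s |v|]
   and Potter's bound compares [f t] with [f a]. *)
have [vt|tv] := leP `|v| (t / (2 * s)).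
  have : f (t / s - v) <= K * (2 * s * w (2 * s)) * f t.
    apply: le_trans (hK t (2 * s) at_ _); last by lra.
    apply: f_le; rewrite ger0_norm; last by rewrite divr_ge0; lra.
    have e1 : t / s = t / (2 * s) + t / (2 * s) by field; rewrite gt_eqF.
    have := ler_norm (t / s - v); have := ler_norm v; lra.
  move=> h; rewrite ler_pdivrMl//; apply: (le_trans h).
  rewrite [leRHS]mulrA ler_pM2r//.
  have := potter_weightM e0 (ltW (ltr0Sn R 1)) (ltW s0).
  rewrite -/w -/d (_ : 1 + 2 = 3); last by lra.
  move=> h2; apply: (@le_trans _ _ (s * (A * w s))).
    have -> : K * (2 * s * w (2 * s)) = s * K * 2 * w (2 * s) by ring.
    have -> : s * (A * w s) = s * K * 2 * (3 `^ d * w s) by rewrite /A; ring.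
    by rewrite ler_pM2l ?mulr_gt0.
  rewrite ler_pM2l// -[leLHS]mulr1; apply: ler_pM vm => //; first exact: mulr_ge0.
  by apply: ler_wpM2r => //; rewrite lerDl.
have v0 : 0 < `|v| by apply: lt_trans tv; rewrite divr_gt0// mulr_gt0.
have ta : t / a <= 2 / a * `|v| * s.
  have /ltW : t < `|v| * (2 * s) by rewrite -ltr_pdivrMr// mulr_gt0.
  rewrite (_ : 2 / a * `|v| * s = `|v| * (2 * s) / a); last by ring.
  by rewrite ler_pM2r// invr_gt0.
have c0 : 0 <= 2 / a * `|v| by rewrite mulr_ge0// divr_ge0// ltW.
have ta0 : 0 < t / a by rewrite divr_gt0.
(* Potter's bound at the scale [t / a], since [t / (t / a) = a]; this is how [f t] is bounded below
   in terms of [t]. *)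
have h1 : f a <= K * (t / a * w (t / a)) * f t.
  have := hK t (t / a) at_ ta0.
  by rewrite invf_div mulrCA divff ?mulr1// gt_eqF.
have h2 : t / a * w (t / a) <= 2 / a * `|v| * s * ((1 + 2 / a * `|v|) `^ d * w s).
  apply: ler_pM => //; [exact: ltW|exact: potter_weight_ge0|].
  apply: (le_trans (potter_weight_le e0 (ltW ta0) ta)).
  by apply: potter_weightM => //; exact: ltW.
have h3 : 2 / a * `|v| * (1 + 2 / a * `|v|) `^ d <=
    (1 + 2 / a) `^ (1 + d) * (1 + `|v|) ^+ m.
  have a20 : 0 <= 2 / a by rewrite divr_ge0// ltW.
  apply: (@le_trans _ _ (((1 + 2 / a) * (1 + `|v|)) `^ (1 + d))).
    have z0 : 0 < (1 + 2 / a) * (1 + `|v|) by rewrite mulr_gt0; lra.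
    rewrite powRD; last by rewrite (gt_eqF z0) implybT.
    rewrite powRr1; last exact: ltW.
    have le : 1 + 2 / a * `|v| <= (1 + 2 / a) * (1 + `|v|).
      by rewrite mulrDl !mulrDr !mul1r mulr1; lra.
    apply: ler_pM => //; [exact: powR_ge0|by apply: le_trans le; rewrite lerDr|].
    by rewrite ge0_ler_powR ?nnegrE// ?(ltW z0)//; lra.
  rewrite powRM; [|lra|lra]; rewrite ler_wpM2l ?powR_ge0//.
  rewrite -powR_mulrn; last by lra.
  by apply: ler_powR => //; lra.
rewrite ler_pdivrMl//.
have f0a : f (t / s - v) <= f 0 by apply: f_le; rewrite normr0.
apply: (le_trans f0a).
have -> : f 0 = f 0 / f a * f a by rewrite divfK// gt_eqF.
apply: (@le_trans _ _ (f 0 / f a * (K * (t / a * w (t / a)) * f t))).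
  by rewrite ler_pM2l ?divr_gt0.
rewrite !mulrA ler_pM2r// -!mulrA.
apply: (@le_trans _ _ (s * B * w s * (1 + `|v|) ^+ m)).
  rewrite /B mulrA mulrA.
  apply: (@le_trans _ _ (f 0 / f a * K * (2 / a * `|v| * s * ((1 + 2 / a * `|v|) `^
      d * w s)))).
    by rewrite -!mulrA ler_pM2l// ler_pM2l ?invr_gt0// ler_pM2l// !mulrA -!mulrA;
        rewrite !mulrA in h2 *.
  set P := (X in _ <= X); set Q := (X in X <= _).
  have -> : Q = (f 0 / f a * K * s * w s) * (2 / a * `|v| * (1 + 2 / a * `|v|) `^ d).
    by rewrite /Q; ring.
  have -> : P = (f 0 / f a * K * s * w s) * ((1 + 2 / a) `^ (1 + d) * (1 + `|v|) ^+ m).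
    by rewrite /P; ring.
  apply: ler_wpM2l => //.
  by rewrite !mulr_ge0 ?invr_ge0 ?(ltW (f_gt0 _)) ?(ltW s0) ?(ltW K0).
set P := (X in _ <= X).
have -> : P = s * (A + B) * w s * (1 + `|v|) ^+ m by rewrite /P /w; ring.
rewrite !ler_wpM2r ?exprn_ge0 ?addr_ge0// ler_wpM2l ?(ltW s0)//.
by rewrite lerDr.
Qed.

End potter.

(** * Limit of the outlier ratio *)

Section tail_ratio.
Variable R : realType.
Implicit Types (c : tail_case) (alpha s t u z : R) (f : R -> R).

Lemma cvg_invr_pinfty : t^-1 @[t --> +oo] --> (0 : R).
Proof.
apply/cvgrVy.
  by near=> t; rewrite invr_gt0; near: t; exact: nbhs_pinfty_gt.
rewrite (_ : unstable.inv_fun _ = id); first exact: cvg_id.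
by apply/funext => t /=; rewrite /unstable.inv_fun invrK.
Unshelve. all: by end_near. Qed.

Lemma cvg_affine_pinfty s u : 0 < s -> (t - u) / s @[t --> +oo] --> +oo.
Proof.
move=> s0; apply/cvgryPge => A; near=> t.
rewrite ler_pdivlMr// lerBrDr; near: t.
exact: nbhs_pinfty_ge (num_real _).
Unshelve. all: by end_near. Qed.

Lemma cvg_ln_pinfty : ln t @[t --> +oo] --> (+oo : set_system R).
Proof.
apply/cvgryPge => A; near=> t.
have t0 : 0 < t by near: t; exact: nbhs_pinfty_gt.
rewrite -[leLHS]expRK ler_ln ?posrE ?expR_gt0//.
Unshelve. all: by end_near. Qed.

Lemma cvg_affine_ratio s u : 0 < s ->
  (t - u) / s / t @[t --> +oo] --> s^-1.
Proof.
move=> s0.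
have : (1 - u * t^-1) * s^-1 @[t --> +oo] --> (1 - u * 0) * s^-1.
  apply: cvgMl; apply: cvgB; first exact: cvg_cst.
  by apply: cvgMr; exact: cvg_invr_pinfty.
rewrite mulr0 subr0 mul1r; apply: cvg_trans; apply: near_eq_cvg.
near=> t; have t0 : 0 < t by near: t; exact: nbhs_pinfty_gt.
by field; rewrite !gt_eqF.
Unshelve. all: by end_near. Qed.

(** The quotient of [(t - u) / s] by [t] tends to [s^-1], so a pure power gives
    [s^-1 * s ^ (alpha + 1)]. In the logarithmic case [ln ((t - u) / s) / ln t] is 1 plus a
    convergent quantity over [ln t], hence tends to 1; the remaining factor [t / (t - u)] tends to 1
    as well, and the scale disappears. *)
Lemma cvg_tail_profile_ratio c alpha s u : 0 < alpha -> 0 < s ->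
  s^-1 * (tail_profile c alpha ((t - u) / s) / tail_profile c alpha t)
    @[t --> +oo] --> outlier_weight c alpha s.
Proof.
move=> al0 s0; have s'0 : 0 < s^-1 by rewrite invr_gt0.
have q := cvg_affine_ratio u s0.
have lq : ln ((t - u) / s / t) @[t --> +oo] --> ln s^-1.
  by apply: continuous_cvg q; exact: continuous_ln.
case: c => /=.
  have : s^-1 * expR (- (alpha + 1) * ln ((t - u) / s / t)) @[t --> +oo]
      --> s^-1 * expR (- (alpha + 1) * ln s^-1).
    apply: cvgMr; apply: continuous_cvg; first exact: continuous_expR.
    exact: cvgMr.
  have -> : s^-1 * expR (- (alpha + 1) * ln s^-1) = s `^ alpha.
    rewrite lnV ?posrE// mulrNN mulrDl mul1r expRD lnK ?posrE//.
    by rewrite mulrCA mulVf ?mulr1 ?gt_eqF// /powR gt_eqF.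
  apply: cvg_trans; apply: near_eq_cvg.
  near=> t; have t0 : 0 < t by near: t; exact: nbhs_pinfty_gt.
  have tu0 : 0 < t - u by rewrite subr_gt0; near: t; exact: nbhs_pinfty_gt (num_real _).
  have z0 : 0 < (t - u) / s by rewrite divr_gt0.
  congr (_ * _); rewrite !gtr0_norm// /powR !gt_eqF// -expRB -mulrBr.
  by rewrite ln_div ?posrE.
have h1 : (1 - u * t^-1)^-1 @[t --> +oo] --> (1 : R).
  rewrite -[X in _ --> X]invr1; apply: cvgV; first exact: oner_neq0.
  rewrite -[X in _ --> X]subr0 -[X in 1 - X](mulr0 u).
  by apply: cvgB; [exact: cvg_cst|apply: cvgMr; exact: cvg_invr_pinfty].
have h2 : 1 + ln ((t - u) / s / t) * (ln t)^-1 @[t --> +oo] --> (1 : R).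
  rewrite -[X in _ --> X]addr0 -[X in 1 + X](mulr0 (ln s^-1)).
  apply: cvgD; first exact: cvg_cst.
  by apply: cvgM => //; exact: (cvg_comp _ _ cvg_ln_pinfty cvg_invr_pinfty).
have h3 : expR (- (alpha + 1) * ln (1 + ln ((t - u) / s / t) * (ln t)^-1))
    @[t --> +oo] --> (1 : R).
  rewrite -[X in _ --> X]expR0 -[X in expR X](mulr0 (- (alpha + 1))).
  apply: continuous_cvg; first exact: continuous_expR.
  by apply: cvgMr; rewrite -ln1; apply: continuous_cvg h2; exact: continuous_ln.
have : (1 - u * t^-1)^-1 *
    expR (- (alpha + 1) * ln (1 + ln ((t - u) / s / t) * (ln t)^-1))
    @[t --> +oo] --> (1 : R).
  by rewrite -[X in _ --> X]mulr1; exact: cvgM h1 h3.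
apply: cvg_trans; apply: near_eq_cvg.
near=> t; have t0 : 0 < t by near: t; exact: nbhs_pinfty_gt.
have t1 : 1 < t by near: t; exact: nbhs_pinfty_gt.
have tu0 : 0 < t - u by rewrite subr_gt0; near: t; exact: nbhs_pinfty_gt (num_real _).
have z0 : 0 < (t - u) / s by rewrite divr_gt0.
have z1 : 1 < (t - u) / s.
  by rewrite ltr_pdivlMr// ltrBrDr; near: t; exact: nbhs_pinfty_gt (num_real _).
have lt0 := ln_gt0 t1; have lz0 := ln_gt0 z1.
rewrite !gtr0_norm//.
have -> : 1 + ln ((t - u) / s / t) * (ln t)^-1 = ln ((t - u) / s) / ln t.
  by rewrite ln_div ?posrE//; field; rewrite gt_eqF.
rewrite [expR _](_ : _ = (ln ((t - u) / s) / ln t) `^ (- (alpha + 1))); last first.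
  by rewrite /powR gt_eqF// divr_gt0.
rewrite powRM ?invr_ge0 ?ltW//.
rewrite (_ : (ln t)^-1 `^ _ = (ln t `^ (- (alpha + 1)))^-1); last first.
  by rewrite -(powR_inv1 (ltW lt0)) powRAC powR_inv1 ?powR_ge0.
have p0 : ln t `^ (- (alpha + 1)) != 0 by rewrite gt_eqF ?powR_gt0.
by field; rewrite p0 !gt_eqF.
Unshelve. all: by end_near. Qed.

Lemma cvg_tail_ratio c alpha f s u : 0 < alpha -> error_density c alpha f ->
  0 < s ->
  s^-1 * f ((t - u) / s) / f t @[t --> +oo] --> outlier_weight c alpha s.
Proof.
move=> al0 fE s0; have [Cf Cf0 [ft _]] := error_tail fE.
have fz := cvg_comp _ _ (cvg_affine_pinfty u s0) ft.
have : f ((t - u) / s) / (Cf * tail_profile c alpha ((t - u) / s)) *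
    (f t / (Cf * tail_profile c alpha t))^-1 *
    (s^-1 * (tail_profile c alpha ((t - u) / s) / tail_profile c alpha t))
    @[t --> +oo] --> outlier_weight c alpha s.
  rewrite -[X in _ --> X]mul1r; apply: cvgM (cvg_tail_profile_ratio u al0 s0).
  rewrite -[X in _ --> X]mulr1; apply: cvgM; first exact: fz.
  by rewrite -[X in _ --> X]invr1; apply: cvgV ft; exact: oner_neq0.
apply: cvg_trans; apply: near_eq_cvg.
have tp : \forall t \near +oo, 0 < tail_profile c alpha t.
  by have [K _] := near_tail_profile c al0; apply: filterS => z [].
have zp : \forall t \near +oo, 0 < tail_profile c alpha ((t - u) / s).
  exact: (@cvg_affine_pinfty s u s0 [set z | 0 < tail_profile c alpha z] tp).
near=> t.
have tt : 0 < tail_profile c alpha t by near: t.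
have tz : 0 < tail_profile c alpha ((t - u) / s) by near: t.
have f0 := error_gt0 fE t.
by rewrite /=; field; rewrite !gt_eqF.
Unshelve. all: by end_near. Qed.

End tail_ratio.

(** * Integration against a density, inverse-gamma and Gaussian integrals *)

Section density.
Context d (T : measurableType d) (R : realType).
Variables (mu : {measure set T -> \bar R}) (w : T -> R).
Hypotheses (mw : measurable_fun setT w) (w0 : forall x, 0 <= w x).

Let mEw : measurable_fun setT (EFin \o w).
Proof. exact/measurable_EFinP. Qed.

Let Ew0 (x : T) : (0 <= (w x)%:E)%E. Proof. by rewrite lee_fin. Qed.

Definition density_content (A : set T) : \bar R := (\int[mu]_(x in A) (w x)%:E)%E.

(** The weight is nonnegative on the whole space, which is why densities given only on a half-line
    or half-space are extended by 0 before this is applied. *)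
Lemma density_measure : exists nu : {measure set T -> \bar R},
  nu = density_content :> (set T -> \bar R).
Proof.
have nu0 : density_content set0 = 0%E by rewrite /density_content integral_set0.
have nu_ge0 A : (0 <= density_content A)%E by apply: integral_ge0.
have nuS : semi_sigma_additive density_content.
  move=> F mF tF mUF; rewrite /density_content ge0_integral_bigcup//; last first.
    exact: measurable_funTS.
  apply: is_cvg_ereal_nneg_natsum_cond => n _ _; exact: integral_ge0.
pose q : {measure set T -> \bar R} :=
  HB.pack density_content (isMeasure.Build _ _ _ density_content nu0 nu_ge0 nuS).
by exists q.
Qed.

Variable nu : {measure set T -> \bar R}.
Hypothesis nuE : forall A, measurable A -> nu A = (\int[mu]_(x in A) (w x)%:E)%E.

Import HBNNSimple.

Let integral_density_nnsfun (g : {nnsfun T >-> R}) :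
  (\int[nu]_x (g x)%:E = \int[mu]_x ((g x)%:E * (w x)%:E))%E.
Proof.
under [LHS]eq_integral do rewrite fimfunE -fsumEFin//.
rewrite [LHS]ge0_integral_fsum//; last 2 first.
  - by move=> r; exact/measurable_EFinP/measurableT_comp.
  - by move=> n x _; rewrite EFinM nnfun_muleindic_ge0.
under [RHS]eq_integral.
  move=> x xD; rewrite fimfunE -fsumEFin// muleC ge0_mule_fsumr; last first.
    by move=> r; rewrite EFinM nnfun_muleindic_ge0.
  over.
rewrite [RHS]ge0_integral_fsum//; last 2 first.
  - move=> r; apply: emeasurable_funM => //.
    by apply/measurable_EFinP; do 2 apply/measurableT_comp => //.
  - by move=> n x _; rewrite EFinM mule_ge0// nnfun_muleindic_ge0.
apply: eq_fsbigr => r _.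
under eq_integral do rewrite EFinM.
rewrite integralZl_indic_nnsfun//= integral_indic//= setIT nuE//.
(* A negative [r] is never a value of [g]: its level set is empty and both sides vanish. *)
have [r0|r0] := leP 0 r; last first.
  have -> : g @^-1` [set r] = set0.
    apply/seteqP; split => // x /= gxr.
    by have : 0 <= g x by []; rewrite gxr leNgt r0.
  rewrite integral_set0 mule0; apply/esym/integral0_eq => x _.
  by rewrite indic0 !(mule0, mulr0).
rewrite -ge0_integralZl//; last exact: measurable_funTS.
rewrite integral_mkcond; apply: eq_integral => x _.
rewrite patchE indicE; case: ifPn => _; last by rewrite mulr0 mule0.
by rewrite mulr1 muleC.
Qed.

Lemma ge0_integral_density (h : T -> \bar R) (D : set T) :
  measurable D -> measurable_fun D h -> (forall x, D x -> (0 <= h x)%E) ->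
  (\int[nu]_(x in D) h x = \int[mu]_(x in D) (h x * (w x)%:E))%E.
Proof.
move=> mD mh h0; rewrite integral_mkcond [RHS]integral_mkcond.
have -> : (fun x => h x * (w x)%:E)%E \_ D = (fun x => (h \_ D) x * (w x)%:E)%E.
  by apply/funext => x; rewrite !patchE; case: ifP => // _; rewrite mul0e.
have {}mh : measurable_fun setT (h \_ D).
  by apply/(measurable_restrictT h mD).
have {}h0 x : (0 <= (h \_ D) x)%E by exact: erestrict_ge0.
move: (h \_ D) mh h0 => {}h mh h0.
pose g := nnsfun_approx measurableT mh.
have gh x : (g n x)%:E @[n --> \oo] --> h x by exact: cvg_nnsfun_approx.
transitivity (lim (\int[nu]_x (g n x)%:E @[n --> \oo])%E).
  rewrite -monotone_convergence//=.
  - by apply: eq_integral => x _; apply/esym/cvg_lim => //; exact: gh.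
  - by move=> n; exact/measurable_EFinP/measurable_funTS.
  - by move=> n ? _; rewrite lee_fin.
  - by move=> ? _ ? ? mn; rewrite lee_fin; exact/lefP/nd_nnsfun_approx.
transitivity (lim (\int[mu]_x ((g n x)%:E * (w x)%:E) @[n --> \oo])%E).
  by apply: congr_lim; apply/funext => n /=; exact: integral_density_nnsfun.
rewrite -monotone_convergence//=.
- apply: eq_integral => x _; apply/cvg_lim => //.
  by apply: cvgeZr => //; exact: gh.
- move=> n; apply: emeasurable_funM => //; exact/measurable_EFinP/measurable_funTS.
- by move=> n x _; rewrite mule_ge0// lee_fin.
- move=> x _ m n mn; rewrite lee_wpmul2r// lee_fin; exact/lefP/nd_nnsfun_approx.
Qed.

Lemma integral_density (h : T -> R) (D : set T) :
  measurable D -> measurable_fun D h ->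
  (\int[nu]_(x in D) (h x)%:E = \int[mu]_(x in D) (h x * w x)%:E)%E.
Proof.
move=> mD mh; rewrite integralE [RHS]integralE.
have mEh : measurable_fun D (EFin \o h) by exact/measurable_EFinP.
rewrite !ge0_integral_density//; [|exact: measurable_funeneg|exact: measurable_funepos].
congr (_ - _)%E; apply: eq_integral => x _.
  by rewrite !funeposE -!EFin_max -EFinM maxr_pMl// mul0r.
by rewrite !funenegE -!EFinN -!EFin_max -EFinM maxr_pMl// mul0r mulNr.
Qed.

End density.

(** * Integrability of inverse-gamma kernels *)

Section inverse_gamma.
Variable R : realType.
Implicit Types (m k r t z shape scale : R).
Local Notation mu := (@lebesgue_measure R).

(** One term of the exponential series at [k * (1 + z)] is enough; [expR k] accounts for the shift
    by 1. The bound serves twice, with [z = t^-1] for the inverse-gamma kernel and with [z] a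
    squared norm for the Gaussian. *)
Lemma expr_le_expR k (N : nat) : 0 < k ->
  exists2 K : R, 0 < K & forall z, 0 <= z -> (1 + z) ^+ N <= K * expR (k * z).
Proof.
move=> k0; pose F : R := N.+1`!%:R.
have F0 : 0 < F by rewrite ltr0n fact_gt0.
exists (expR k * F / k ^+ N.+1) => [|z z0].
  by rewrite !mulr_gt0 ?expR_gt0 ?invr_gt0 ?exprn_gt0.
apply: (@le_trans _ _ ((1 + z) ^+ N.+1)).
  by rewrite ler_weXn2l// lerDl.
have := expR_ge1Dxn N (mulr_ge0 (ltW k0) (addr_ge0 ler01 z0)).
rewrite mulrDr mulr1 expRD => h.
have {}h : (k + k * z) ^+ N.+1 / F <= expR k * expR (k * z).
  by apply: le_trans h; rewrite lerDr.
rewrite ler_pdivrMr// in h.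
have -> : expR k * F / k ^+ N.+1 * expR (k * z) =
    (expR k * expR (k * z) * F) / k ^+ N.+1 by ring.
by rewrite ler_pdivlMr ?exprn_gt0// mulrC -exprMn mulrDr mulr1.
Qed.

Lemma is_derive_powR1D r t : 0 < 1 + t ->
  is_derive t 1 (fun u : R => (1 + u) `^ r) (r * (1 + t) `^ (r - 1)).
Proof.
move=> t0; rewrite -[X in is_derive _ _ _ X]mulr1.
apply: (is_derive1_comp (f := fun u : R => u `^ r) (g := fun u : R => 1 + u)).
  exact: is_derive1_powR.
by rewrite -[X in is_derive _ _ _ X]add0r; apply: is_deriveD.
Qed.

Lemma integral_powR_lty m : 1 < m ->
  (\int[mu]_(t in `]0%R, +oo[) ((1 + t) `^ (- m))%:E < +oo)%E.
Proof.
move=> m1; pose F t : R := (1 - m)^-1 * (1 + t) `^ (1 - m).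
have dF t : 0 < 1 + t -> is_derive t 1 F ((1 + t) `^ (- m)).
  move=> t0; have := is_deriveZ (1 - m)^-1 (is_derive_powR1D (1 - m) t0).
  rewrite /GRing.scale/= mulrA mulVf ?mul1r; last by rewrite subr_eq0 lt_eqF.
  by rewrite (_ : 1 - m - 1 = - m)//; ring.
have cvg_derive (G : R -> R) t u : is_derive t 1 G u -> {for t, continuous G}.
  by move=> [dG _]; apply: differentiable_continuous; exact/derivable1_diffP.
apply: (@le_lt_trans _ _ (\int[mu]_(t in `[0%R, +oo[) ((1 + t) `^ (- m))%:E)%E).
  apply: ge0_subset_integral => //=.
  - apply/measurable_EFinP; apply: measurable_funTS.
    by apply: (measurableT_comp (measurable_powR _)); exact: measurable_funD.
  - by move=> t _; rewrite lee_fin powR_ge0.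
  - by move=> t; rewrite /= !in_itv/= !andbT => /ltW.
rewrite (@ge0_continuous_FTC2y _ _ F 0 0).
- by rewrite -EFinB ltry.
- by move=> t t0; rewrite powR_ge0.
- apply: continuous_in_subspaceT => t; rewrite inE/= in_itv/= andbT => t0.
  by apply: cvg_derive; apply: is_derive_powR1D; lra.
- rewrite -[X in _ --> X](mulr0 (1 - m)^-1); apply: cvgMr.
  have h : (m - 1) * ln (1 + t) @[t --> +oo] --> +oo.
    apply: gt0_cvgMry; first lra.
    have := @cvg_affine_pinfty R 1 (-1) ltr01.
    rewrite (_ : (fun t => _) = (fun t => 1 + t)).
      by move=> /cvg_comp; apply; exact: cvg_ln_pinfty.
    by apply/funext => t; rewrite divr1 opprK addrC.
  have := cvg_comp _ _ h (@cvgr_expR R); apply: cvg_trans; apply: near_eq_cvg.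
  near=> t; have t0 : 0 < 1 + t by apply: ltr_wpDr => //; near: t; exact: nbhs_pinfty_ge.
  by rewrite /= /powR gt_eqF// -mulNr opprB.
- by move=> t t0; have := dF t; case=> //; lra.
- by apply: cvg_at_right_filter; apply: cvg_derive; apply: dF; lra.
- move=> t; rewrite in_itv/= andbT => t0.
  have t1 : 0 < 1 + t by lra.
  by rewrite derive1E; have -> := derive_val (is_derive := dF t t1).
Unshelve. all: by end_near. Qed.

Lemma measurable_inv_gt0 :
  measurable_fun (`]0, +oo[%classic : set R) (fun t : R => t^-1).
Proof.
apply: open_continuous_measurable_fun => // t.
rewrite inE/= in_itv/= andbT => t0.
by apply: inv_continuous; rewrite gt_eqF.
Qed.

(** The power t^(-m) equals (1 + 1/t)^m (1 + t)^(-m). The exponential absorbs the first factor,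
    which carries the whole singularity at 0, and the second is integrable because [1 < m]. *)
Lemma integral_invgamma_kernel_lty m k : 1 < m -> 0 < k ->
  (\int[mu]_(t in `]0%R, +oo[) (t `^ (- m) * expR (- k / t))%:E < +oo)%E.
Proof.
move=> m1 k0; pose N := (Num.truncn m).+1.
have mN : m <= N%:R by apply/ltW; rewrite truncnS_gt.
have [K K0 hK] := expr_le_expR N k0.
apply: (@le_lt_trans _ _
  (\int[mu]_(t in `]0%R, +oo[) (K%:E * ((1 + t) `^ (- m))%:E))%E).
  apply: ge0_le_integral => //=.
  - by move=> t _; rewrite lee_fin mulr_ge0 ?powR_ge0 ?expR_ge0.
  - apply/measurable_EFinP; apply: measurable_funM.
      by apply: measurable_funTS; exact: measurable_powR.
    apply: measurableT_comp; first exact: measurable_expR.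
    by apply: measurable_funM => //; exact: measurable_inv_gt0.
  - apply/measurable_EFinP; apply: measurable_funM => //; apply: measurable_funTS.
    by apply: (measurableT_comp (measurable_powR _)); exact: measurable_funD.
  - move=> t; rewrite in_itv/= andbT => t0; rewrite -EFinM lee_fin.
    have ti0 : 0 < t^-1 by rewrite invr_gt0.
    rewrite mulNr expRN ler_pdivrMr ?expR_gt0//.
    have -> : t `^ (- m) = (1 + t^-1) `^ m * (1 + t) `^ (- m).
      rewrite (_ : 1 + t^-1 = (1 + t) * t^-1); last by field; rewrite gt_eqF.
      rewrite powRM; [|lra|lra]; rewrite mulrAC -powRD; last first.
        by apply/implyP => _; rewrite gt_eqF//; lra.
      by rewrite subrr powRr0 mul1r -(powR_inv1 (ltW t0)) -powRrM mulN1r.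
    rewrite mulrAC ler_wpM2r ?powR_ge0//.
    apply: le_trans (hK _ (ltW ti0)).
    by rewrite -powR_mulrn; [apply: ler_powR => //; lra|lra].
rewrite ge0_integralZl_EFin ?(ltW K0)//.
- by rewrite lte_mul_pinfty ?lee_fin ?(ltW K0)//; exact: integral_powR_lty.
- by move=> t _; rewrite lee_fin powR_ge0.
- apply/measurable_EFinP; apply: measurable_funTS.
  by apply: (measurableT_comp (measurable_powR _)); exact: measurable_funD.
Qed.

End inverse_gamma.

(** * Negative moments of the scale under the prior *)

Section sigma_prior.
Variables (R : realType) (shape scale : R) (q : R -> R).
Hypotheses (shape_gt0 : 0 < shape) (scale_gt0 : 0 < scale).
Hypotheses (mq : measurable_fun (`]0, +oo[ : set R) q)
  (q_ge0 : forall s, 0 < s -> 0 <= q s).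
Hypothesis q_law : forall B : set R, measurable B ->
  (\int[lebesgue_measure]_(s in `]0%R, +oo[ `&` [set s | B (s ^+ 2)%R]) (q s)%:E
   = \int[lebesgue_measure]_(t in `]0%R, +oo[ `&` B)
       (invgamma_pdf shape scale t)%:E)%E.
Local Notation mu := (@lebesgue_measure R).

Let kernel_ge0 t : 0 <= invgamma_kernel shape scale t.
Proof. by rewrite mulr_ge0 ?powR_ge0 ?expR_ge0. Qed.

Let measurable_kernel : measurable_fun (`]0, +oo[ : set R) (invgamma_kernel shape scale).
Proof.
apply: measurable_funM.
  by apply: measurable_funTS; exact: measurable_powR.
apply: measurableT_comp; first exact: measurable_expR.
by apply: measurable_funM => //; exact: measurable_inv_gt0.
Qed.

Let normalizer := (\int[mu]_(u in `]0%R, +oo[) (invgamma_kernel shape scale u)%:E)%E.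

Let normalizer_lty : (normalizer < +oo)%E.
Proof.
have := @integral_invgamma_kernel_lty R (shape + 1) scale.
rewrite /normalizer (_ : - (shape + 1) = - shape - 1); last by ring.
by apply => //; rewrite ltrDr.
Qed.

(** A zero integral would make a positive kernel vanish almost everywhere on a half-line of infinite
    measure. Together with finiteness, this ensures that dividing by [fine] in [invgamma_pdf] really
    normalizes. *)
Let normalizer_gt0 : (0 < normalizer)%E.
Proof.
rewrite lt0e integral_ge0 ?andbT; last by move=> t _; rewrite lee_fin.
apply/eqP => h.
have : ae_eq mu `]0, +oo[%classic (EFin \o invgamma_kernel shape scale) (cst 0%E).
  apply/(ae_eq_integral_abs mu) => //; first exact/measurable_EFinP.
  by rewrite -[RHS]h; apply: eq_integral => t _; rewrite gee0_abs ?lee_fin.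
move=> [N [mN N0 subN]].
have : (mu `]0%R, +oo[%classic <= mu N)%E.
  apply: le_measure; rewrite ?inE//; apply: subset_trans subN => t t0 /=.
  move=> /(_ t0)[]/eqP; apply/negP; rewrite gt_eqF// mulr_gt0 ?expR_gt0//.
  by rewrite powR_gt0//; move: t0; rewrite /= in_itv/= andbT.
by rewrite N0 lebesgue_measure_itv/= ltry.
Qed.

Let normalizer_fin : normalizer \is a fin_num.
Proof. by rewrite ge0_fin_numE// ltW. Qed.

Let fine_normalizer_gt0 : 0 < fine normalizer.
Proof. by rewrite fine_gt0// normalizer_gt0. Qed.

Lemma integral_sigma_prior : (\int[mu]_(s in `]0%R, +oo[) (q s)%:E = 1)%E.
Proof.
have := q_law measurableT.
have -> : [set s : R | [set: R] (s ^+ 2)] = setT by apply/seteqP; split.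
rewrite !setIT => ->; rewrite /invgamma_pdf -/normalizer.
under eq_integral do rewrite mulrC EFinM.
rewrite ge0_integralZl_EFin ?invr_ge0 ?(ltW fine_normalizer_gt0)//.
- by rewrite -/normalizer -(fineK normalizer_fin) -EFinM mulVf ?gt_eqF.
- by move=> t _; rewrite lee_fin.
- exact/measurable_EFinP.
Qed.

(** Since sigma^(-r) is the power -r/2 of sigma^2, the moment is an inverse-gamma integral whose
    shape is raised by r/2, and it converges for every [r]. *)
Lemma integral_sigma_prior_powR r : 0 <= r ->
  (\int[mu]_(s in `]0%R, +oo[) (q s * s `^ (- r))%:E < +oo)%E.
Proof.
move=> r0; pose D : set R := `]0, +oo[%classic.
have mD : measurable D by exact: measurable_itv.
pose q' : measurableTypeR R -> R := q \_ D.
pose g : measurableTypeR R -> R := (invgamma_pdf shape scale) \_ D.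
have mg0 : measurable_fun D (invgamma_pdf shape scale) by apply: measurable_funM.
have mq' : measurable_fun setT q' by exact: (measurable_restrictT q mD).1 mq.
have mg : measurable_fun setT g by exact: (measurable_restrictT _ mD).1 mg0.
have q'0 s : 0 <= q' s.
  rewrite /q' patchE; case: ifPn => // /[!inE]/=.
  by rewrite /D/= in_itv/= andbT; exact: q_ge0.
have g0 s : 0 <= g s.
  by rewrite /g patchE; case: ifPn => // _; rewrite mulr_ge0 ?invr_ge0 ?(ltW
      fine_normalizer_gt0).
have [rho rhoE] := density_measure mu mq' q'0.
have [nu nuE] := density_measure mu mg g0.
(* The hypothesis [q_law] identifies the image of the law of [sigma] under the
   square with the inverse-gamma law. *)
pose sq (s : measurableTypeR R) : measurableTypeR R := (s : R) ^+ 2.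
have msq : measurable_fun setT sq by exact: measurable_funX.
pose h (t : measurableTypeR R) := (t `^ (- (r / 2)))%:E.
have mh : measurable_fun setT h by apply/measurable_EFinP; exact: measurable_powR.
have h0 t : (0 <= h t)%E by rewrite lee_fin powR_ge0.
have patch_int (u : R -> R) (k : R -> \bar R) A : measurable A ->
  (\int[mu]_(x in A) (k x * ((u \_ D) x)%:E)
   = \int[mu]_(x in D `&` A) (k x * (u x)%:E))%E.
  move=> mA; rewrite [RHS]integral_mkcondl; apply: eq_integral => x _.
  by rewrite !patchE; case: ifPn => // _; rewrite mule0.
have patch_int1 (u : R -> R) A : measurable A ->
  (\int[mu]_(x in A) ((u \_ D) x)%:E = \int[mu]_(x in D `&` A) (u x)%:E)%E.
  move=> mA; have := patch_int u (fun=> 1%E) A mA.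
  by under eq_integral do rewrite mul1e; under [in RHS]eq_integral do rewrite mul1e.
have E : (\int[pushforward rho sq]_t h t = \int[nu]_t h t)%E.
  apply: (@eq_measure_integral _ _ _ setT nu
    (measure_function_pushforward__canonical__measure_function_Measure rho msq)).
  move=> A mA _; rewrite /= /pushforward rhoE nuE.
  have mB : measurable (sq @^-1` A) by rewrite -[X in measurable X]setTI; exact: msq.
  by rewrite /density_content !patch_int1//; exact: q_law.
move: E; rewrite ge0_integral_pushforward// preimage_setT.
rewrite (ge0_integral_density (mu := mu) mq' q'0) //; last 3 first.
- by move=> A mA; rewrite rhoE.
- exact: measurableT_comp.
- by move=> x _; exact: h0.
rewrite (ge0_integral_density (mu := mu) mg g0 (nu := nu)) //; last by move=> A mA;
    rewrite nuE.
rewrite !patch_int// !setIT => E.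
rewrite (eq_integral (fun x => (h \o sq) x * (q x)%:E)%E); last first.
  move=> s; rewrite inE/= in_itv/= andbT => s0.
  rewrite /h /sq/= -EFinM mulrC; congr (_ * _)%:E.
  by rewrite -powR_mulrn ?(ltW s0)// -powRrM; congr (s `^ _); field.
rewrite E.
rewrite (eq_integral (fun t : measurableTypeR R => (fine normalizer)^-1%:E *
    (t `^ (- (r / 2 + shape + 1)) * expR (- scale / t))%:E)%E); last first.
  move=> t; rewrite inE /D/= in_itv/= andbT => t0.
  rewrite /h /invgamma_pdf -/normalizer -!EFinM /invgamma_kernel; congr EFin.
  rewrite (_ : - (r / 2 + shape + 1) = - (r / 2) + (- shape - 1)); last by ring.
  by rewrite [in RHS]powRD; [ring|rewrite (gt_eqF t0) implybT].
have m1 : 1 < r / 2 + shape + 1.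
  by rewrite ltrDr ltr_wpDl// divr_ge0.
rewrite ge0_integralZl_EFin ?invr_ge0 ?(ltW fine_normalizer_gt0)//.
- by rewrite lte_mul_pinfty ?lee_fin ?invr_ge0 ?(ltW fine_normalizer_gt0)//;
    exact: integral_invgamma_kernel_lty.
- by move=> t _; rewrite lee_fin mulr_ge0 ?powR_ge0 ?expR_ge0.
- apply/measurable_EFinP; apply: measurable_funM.
    by apply: measurable_funTS; exact: measurable_powR.
  apply: measurableT_comp; first exact: measurable_expR.
  by apply: measurable_funM => //; exact: measurable_inv_gt0.
Qed.

End sigma_prior.

(** * Product Gaussian densities on R^p *)

Section product_integral.
Variable R : realType.
Local Notation mu := (@lebesgue_measure R).

Lemma cV_cons0 n (t : R) (b : 'cV[R]_n) i :
  @cV_cons R n (t, b) ord0 i = t.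
Proof.
rewrite /cV_cons/= [i]ord1 (_ : ord0 = lshift n (ord0 : 'I_1)); last exact/val_inj.
by rewrite col_mxEu mxE eqxx.
Qed.

Lemma cV_consS n (t : R) (b : 'cV[R]_n) i j :
  @cV_cons R n (t, b) (lift ord0 i) j = b i j.
Proof.
rewrite /cV_cons/= (_ : lift ord0 i = rshift 1 i); last exact/val_inj.
by rewrite col_mxEd.
Qed.

Lemma ge0_integral_vec_lebesgueS n (h : 'cV[R]_n.+1 -> \bar R) :
  measurable_fun setT h -> (forall b, (0 <= h b)%E) ->
  (\int[@vec_lebesgue R n.+1]_b h b =
   \int[mu]_t \int[@vec_lebesgue R n]_b h (@cV_cons R n (t, b)))%E.
Proof.
move=> mh h0.
transitivity (\int[mu \x (@vec_lebesgue R n)]_z (h \o @cV_cons R n) z)%E.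
  rewrite -[LHS]/(\int[pushforward (mu \x (@vec_lebesgue R n))%E (@cV_cons R n)]_b h b)%E.
  rewrite ge0_integral_pushforward ?preimage_setT//.
  exact: measurable_cV_cons.
apply: fubini_tonelli1 => [|z]; last exact: h0.
exact: (measurableT_comp mh (@measurable_cV_cons R n)).
Qed.

(** The induction follows the recursion of [vec_lebesgue]; in dimension 0 the measure is a Dirac
    mass and the empty product is 1. *)
Lemma integral_prod_coord n (g : R -> R) : measurable_fun setT g ->
  (forall t, 0 <= g t) -> (\int[mu]_t (g t)%:E = 1)%E ->
  (\int[@vec_lebesgue R n]_b (\prod_(i < n) g (b i ord0))%:E = 1)%E.
Proof.
move=> mg g0 g1.
have mP m : measurable_fun setT (fun b : 'cV[R]_m => \prod_(i < m) g (b i ord0)).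
  apply: measurable_prod => i _; apply: measurableT_comp => //.
  exact: measurable_mx_coord.
elim: n => [|n IH].
  rewrite -[LHS]/(\int[\d_ (0%R : 'cV[R]_0)]_b (\prod_(i < 0) g (b i ord0))%:E)%E.
  rewrite integral_dirac ?diracT ?big_ord0 ?mul1e//.
  by apply/measurable_EFinP; exact: mP.
rewrite ge0_integral_vec_lebesgueS; [|by apply/measurable_EFinP; exact: mP|]; last first.
  by move=> b; rewrite lee_fin prodr_ge0.
rewrite -[RHS]g1; apply: eq_integral => t _.
under eq_integral => b _.
  rewrite big_ord_recl cV_cons0.
  under eq_bigr do rewrite cV_consS.
  rewrite EFinM; over.
rewrite ge0_integralZl_EFin//.
- by rewrite IH mule1.
- by move=> b _; rewrite lee_fin prodr_ge0.
- by apply/measurable_EFinP; exact: mP.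
Qed.

Lemma integral_gaussian_vec n (s : R) : s != 0 ->
  (\int[@vec_lebesgue R n]_b
    (\prod_(i < n) normal_pdf 0 s (b i ord0))%:E = 1)%E.
Proof.
move=> s0; apply: integral_prod_coord.
- exact: measurable_normal_pdf.
- by move=> t; exact: normal_pdf_ge0.
- exact: integral_normal_pdf.
Qed.

Lemma prod_normal_pdf n (s : R) (b : 'cV[R]_n) : 0 < s ->
  \prod_(i < n) normal_pdf 0 s (b i ord0) =
  (Num.sqrt (2 * pi)) ^- n * s ^- n *
    expR (- ((b^T *m b) ord0 ord0 / (2 * s ^+ 2))).
Proof.
move=> s0; rewrite mxE.
under eq_bigr do rewrite normal_pdfE ?gt_eqF// /normal_peak /normal_fun.
rewrite big_split/= prodr_const card_ord -expR_sum; congr (_ * _).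
  rewrite -exprVn -!exprVn -exprMn; congr (_ ^+ n).
  rewrite -invfM; congr (_^-1).
  by rewrite (_ : s ^+ 2 * pi *+ 2 = (2 * pi) * s ^+ 2);
    [rewrite sqrtrM ?mulr_ge0 ?pi_ge0// sqrtr_sqr gtr0_norm|ring].
congr expR; rewrite mulr_suml -sumrN; apply: eq_bigr => i _.
by rewrite mxE subr0 -expr2 mulNr mulr_natl.
Qed.

End product_integral.

(** * Functions on the parameter space *)

Section parameter_space.
Variables (R : realType) (p : nat).
Implicit Types (t : R) (z : 'cV[R]_p * R).
Local Notation mu := (@lebesgue_measure R).
Local Notation Lam := (@vec_lebesgue R p \x mu)%E.
Local Notation Par := (@parameters R p).

Lemma measurable_parameters :
  measurable (Par : set ('cV[R]_p * measurableTypeR R)).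
Proof.
rewrite (_ : Par = setT `*` `]0, +oo[%classic); first exact: measurableX.
by apply/seteqP; split => -[b s] /=; rewrite in_itv/= andbT => // -[].
Qed.

(** The grid point of mesh [1 / (n + 1)] next above [t], strictly; it depends on [t] only through an
    integer. *)
Definition round_up (n : nat) t : R :=
  (Num.floor (t * n.+1%:R) + 1)%:~R / n.+1%:R.

Lemma round_up_gt n t : t < round_up n t.
Proof. by rewrite ltr_pdivlMr// floorD1_gt. Qed.

Lemma round_up_le n t : round_up n t <= t + n.+1%:R^-1.
Proof.
by rewrite ler_pdivrMr// mulrDl mulVf// intrD lerD2r floor_le.
Qed.

Lemma cvg_round_up (h : 'cV[R]_p * R -> R) (bs : 'cV[R]_p * R) :
  {within Par, continuous h} -> Par bs ->
  h (map_mx (round_up n) bs.1, round_up n bs.2) @[n --> \oo] --> h bs.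
Proof.
move=> /subspace_continuousP ch Pbs W /(ch _ Pbs)/nbhs_ballP[e/= e0 hW].
have : \forall n \near \oo, n.+1%:R^-1 < e.
  by near=> n; near: n; exact: near_infty_natSinv_lt (PosNum e0).
apply: filterS => n ne; apply: hW => /=; last first.
  exact: lt_trans Pbs (round_up_gt n bs.2).
have rnd_ball t : ball t e (round_up n t).
  rewrite /ball/= ler0_norm; last by rewrite subr_le0 ltW// round_up_gt.
  by rewrite opprB ltrBlDl (le_lt_trans (round_up_le n t))// ltrD2l.
split => //=; split => // i j; rewrite mxE; exact: rnd_ball.
Unshelve. all: by end_near. Qed.

(* [h] is the pointwise limit of its compositions with [round_up n], which factor
   through a countable type; rounding up keeps the scale positive. *)
Lemma measurable_within_continuous (h : 'cV[R]_p * R -> R) :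
  {within Par, continuous h} ->
  measurable_fun (Par : set ('cV[R]_p * measurableTypeR R)) h.
Proof.
move=> ch; apply: (measurable_fun_cvg (h := fun n (bs : 'cV[R]_p * measurableTypeR R) =>
  h (map_mx (round_up n) bs.1, round_up n bs.2))); last first.
  by move=> bs Pbs; exact: cvg_round_up.
move=> n; apply: measurable_funTS => _ Y mY; rewrite setTI.
pose fl t : int := Num.floor (t * n.+1%:R).
pose unfl (k : int) : R := (k + 1)%:~R / n.+1%:R.
pose code (bs : 'cV[R]_p * measurableTypeR R) : 'cV[int]_p * int :=
  (map_mx fl bs.1, fl bs.2).
pose F (k : 'cV[int]_p * int) : set ('cV[R]_p * measurableTypeR R) :=
  [set bs | code bs = k /\ Y (h (map_mx unfl k.1, unfl k.2))].
(* The rounded point is constant on each cell [code bs = k]. The preimage is thus the union of the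
   cells whose constant value lies in [Y]: there are countably many, and each is a box cut out by
   conditions on single coordinates. *)
rewrite (_ : _ @^-1` _ = \bigcup_k F k); last first.
  apply/seteqP; split => [bs /= Ybs|bs [k _ [/= <-]]].
    by exists (code bs) => //; split => //=; rewrite -map_mx_comp.
  by rewrite /= -map_mx_comp.
apply: countable_bigcupT_measurable => [|k]; first exact: countableP.
have [Yk|nYk] := pselect (Y (h (map_mx unfl k.1, unfl k.2))); last first.
  by rewrite (_ : F k = set0)//; apply/seteqP; split => // bs [].
have mfl (l : int) : measurable [set t : measurableTypeR R | fl t = l].
  rewrite (_ : [set t | _] = (fun t : R => t * n.+1%:R) @^-1` `[l%:~R, (l +
      1)%:~R[%classic).
    rewrite -[X in measurable X]setTI.
    by apply: measurable_funM => //; exact: measurable_itv.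
  apply/seteqP; split => t; rewrite /= in_itv/= /fl; last exact: floor_def.
  by move=> <-; exact: floor_itv.
rewrite (_ : F k = (\bigcap_(i in [set: 'I_p])
    ((fun bs : 'cV[R]_p * measurableTypeR R => bs.1 i ord0) @^-1` [set t | fl t =
        k.1 i ord0]))
  `&` snd @^-1` [set t | fl t = k.2]); last first.
  apply/seteqP; split => [bs [<- _]|bs [/= b1 b2]]; first by split => //= i _;
      rewrite mxE.
  split => //; rewrite [RHS]surjective_pairing /code b2; congr pair.
  by apply/matrixP => i j; rewrite mxE [j]ord1; exact: b1.
apply: measurableI.
  apply: fin_bigcap_measurable => // i _; rewrite -[X in measurable X]setTI.
  apply: (measurableT_comp (f := fun b : 'cV[R]_p => b i ord0)) => //.
    exact: measurable_mx_coord.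
  exact: mfl.
rewrite -[X in measurable X]setTI; apply: measurable_snd => //; exact: mfl.
Qed.

(** Tonelli's theorem replaces the iterated integral by one over the product measure, so that
    dominated convergence applies jointly in [beta] and [sigma]. *)
Lemma marginalE (K : 'cV[R]_p -> R -> R) :
  measurable_fun (Par : set ('cV[R]_p * measurableTypeR R)) (fun bs => K bs.1 bs.2) ->
  (forall b s, 0 < s -> 0 <= K b s) ->
  marginal K = (\int[Lam]_(bs in Par) (K bs.1 bs.2)%:E)%E.
Proof.
move=> mK K0.
have mEK : measurable_fun (Par : set ('cV[R]_p * measurableTypeR R))
    (EFin \o (fun bs => K bs.1 bs.2)) by exact/measurable_EFinP.
rewrite integral_mkcond fubini_tonelli1; last 2 first.
- exact: (measurable_restrictT _ measurable_parameters).1 mEK.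
- by apply: erestrict_ge0 => -[b s] /= s0; rewrite lee_fin K0.
rewrite /marginal; apply: eq_integral => b _.
rewrite [LHS]integral_mkcond; apply: eq_integral => s _.
rewrite !patchE; congr (if _ then _ else _).
by apply/idP/idP; rewrite !inE/= in_itv/= andbT.
Qed.

End parameter_space.

(** * Domination of the normalized likelihood *)

Section likelihood_ratio.
Variables (R : realType) (n p : nat) (c : tail_case) (alpha : R) (f : R -> R).
Variables (x : 'I_n -> 'cV[R]_p) (s : 'I_n -> bool) (a b : 'I_n -> R).
Hypotheses (alpha_gt0 : 0 < alpha) (fE : error_density c alpha f).
Hypotheses (a_gt0 : forall i, 0 < a i) (b_cases : forall i, b i = 0 \/ 1 <= b i).
Local Notation O := (outliers b).
Local Notation y := (response s a b).
Implicit Types (beta : 'cV[R]_p) (sigma omega : R).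

Let lin i beta : R := ((x i)^T *m beta) ord0 ord0.

Let f_gt0 z : 0 < f z. Proof. exact: error_gt0 fE _. Qed.

Definition outlier_factor omega i beta sigma : R :=
  sigma^-1 * f ((y omega i - lin i beta) / sigma) / f (y omega i).

Lemma f_sign (e : bool) t : f ((-1) ^+ e * t) = f t.
Proof. by rewrite (error_even fE) normrMsign -(error_even fE). Qed.

(** An inlier has [b i = 0], so its response can be frozen at [omega = 0]; all dependence on [omega]
    is left in the outlier factors. *)
Lemma full_jointE prior omega beta sigma :
  full_joint f prior x (y omega) beta sigma / \prod_(i in O) f (y omega i) =
  prior beta sigma * (\prod_(i in O) outlier_factor omega i beta sigma) *
  likelihood f x (y 0) (~: O)%SET beta sigma.
Proof.
rewrite /full_joint /likelihood (bigID (fun i => i \in O))/=.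
rewrite [X in _ * (X * _)](_ : _ = \prod_(i in O)
    (sigma^-1 * f ((y omega i - lin i beta) / sigma))); last first.
  by apply: eq_bigl => i; rewrite !inE.
rewrite [X in _ * (_ * X)](_ : _ = likelihood f x (y 0) (~: O)%SET beta sigma);
    last first.
  apply: eq_big => [i|i]; first by rewrite !inE.
  rewrite !inE/= -ltNge => b1; have -> // : y omega i = y 0 i.
  rewrite /response; case: (b_cases i) => [->|]; first by rewrite !mul0r.
  by rewrite leNgt b1.
have -> : \prod_(i in O) outlier_factor omega i beta sigma =
    \prod_(i in O) (sigma^-1 * f ((y omega i - lin i beta) / sigma)) /
    \prod_(i in O) f (y omega i) by rewrite -prodf_div.
by rewrite -/(likelihood f x (y 0) (~: O)%SET beta sigma); ring.
Qed.

(** Evenness of [f] moves the sign of the response onto the linear predictor, so the limit at [+oo]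
    covers outliers of both signs. *)
Lemma cvg_outlier_factor i beta sigma : i \in O -> 0 < sigma ->
  outlier_factor omega i beta sigma @[omega --> +oo] --> outlier_weight c alpha sigma.
Proof.
rewrite inE => bi s0.
have ab : a i + b i * omega @[omega --> +oo] --> +oo.
  apply/cvgryPge => A; near=> omega.
  have w0 : 0 <= omega by near: omega; exact: nbhs_pinfty_ge.
  have wA : A <= omega by near: omega; exact: nbhs_pinfty_ge (num_real _).
  have := a_gt0 i; nra.
have := cvg_comp _ _ ab (cvg_tail_ratio ((-1) ^+ s i * lin i beta) alpha_gt0 fE s0).
rewrite (_ : _ \o _ = fun omega => outlier_factor omega i beta sigma)//.
apply/funext => omega /=; rewrite /outlier_factor /response f_sign.
congr (_ * _ / _); rewrite -(f_sign (s i)); congr f.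
by rewrite mulrA mulrBr mulrA -signr_addb addbb mul1r.
Unshelve. all: by end_near. Qed.

Lemma cvg_full_joint prior beta sigma : 0 < sigma ->
  full_joint f prior x (y omega) beta sigma / \prod_(i in O) f (y omega i)
    @[omega --> +oo] --> robust_joint c alpha f prior x (y 0) O beta sigma.
Proof.
move=> s0; under eq_fun do rewrite full_jointE.
rewrite /robust_joint; apply: cvgMl; apply: cvgMr.
rewrite -prodr_const -!big_enum/=.
under eq_fun do rewrite -big_enum/=.
have : all (mem O) (enum O) by apply/allP => i; rewrite mem_enum.
elim: (enum O) => [|i r IH]/=.
  by move=> _; rewrite big_nil; under eq_fun do rewrite big_nil; exact: cvg_cst.
move=> /andP[iO rO].
rewrite (_ : (fun omega => _) = (fun omega => outlier_factor omega i beta sigma *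
    \prod_(j <- r) outlier_factor omega j beta sigma)); last first.
  by apply/funext => omega; rewrite big_cons.
by rewrite big_cons; apply: cvgM; [exact: cvg_outlier_factor|exact: IH].
Qed.

Let c_lin i : R := \sum_j `|x i j ord0|.

Definition scaled_sqnorm beta sigma : R :=
  (beta^T *m beta) ord0 ord0 / sigma ^+ 2.

Lemma scaled_sqnorm_ge0 beta sigma : 0 <= scaled_sqnorm beta sigma.
Proof.
rewrite /scaled_sqnorm divr_ge0 ?sqr_ge0// mxE sumr_ge0// => j _.
by rewrite mxE -expr2 sqr_ge0.
Qed.

(** The inequality [|r| <= 1 + r ^+ 2], applied to each coordinate of [beta / sigma], trades the
    norm for the squared norm that appears in the Gaussian exponent. *)
Lemma lin_le i beta sigma : 0 < sigma ->
  `|lin i beta / sigma| <= c_lin i * (1 + scaled_sqnorm beta sigma).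
Proof.
move=> s0; rewrite /lin mxE mulr_suml; apply: (le_trans (ler_norm_sum _ _ _)).
rewrite /c_lin mulr_suml; apply: ler_sum => j _.
rewrite mxE -mulrA normrM ler_wpM2l//.
have h : (beta j ord0 / sigma) ^+ 2 <= scaled_sqnorm beta sigma.
  rewrite /scaled_sqnorm exprMn exprVn ler_wpM2r ?invr_ge0 ?sqr_ge0//.
  rewrite mxE (bigD1 j)//= mxE -expr2 lerDl sumr_ge0// => k _.
  by rewrite mxE -expr2 sqr_ge0.
have : `|beta j ord0 / sigma| <= 1 + (beta j ord0 / sigma) ^+ 2.
  by rewrite -real_normK ?num_real//; have := sqr_ge0 (`|beta j ord0 / sigma| - 1); nra.
lra.
Qed.

Lemma outlier_factors_bound e : 0 < e ->
  exists (K : R) (m : nat), 0 < K /\ forall omega beta sigma,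
    0 < omega -> 0 < sigma ->
    \prod_(i in O) outlier_factor omega i beta sigma <=
    K * potter_weight c alpha e sigma ^+ #|O| * (1 + scaled_sqnorm beta sigma) ^+ m.
Proof.
move=> e0.
have /choice[Km hKm] : forall i, exists Km : R * nat, 0 < Km.1 /\
    forall t sigma v, a i <= t -> 0 < sigma ->
    sigma^-1 * f (t / sigma - v) <=
    Km.1 * potter_weight c alpha e sigma * (1 + `|v|) ^+ Km.2 * f t.
  by move=> i; have [K [m h]] := outlier_ratio_bound alpha_gt0 fE (a_gt0 i) e0;
      exists (K, m).
have cl0 i : 0 <= c_lin i by apply: sumr_ge0.
(* Constants multiply and degrees add over the outliers; the powers of [1 + c_lin i] come from
   bounding [1 + |x^T u|] by [(1 + c_lin i) * (1 + |u| ^+ 2)]. *)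
exists (\prod_(i in O) ((Km i).1 * (1 + c_lin i) ^+ (Km i).2)), (\sum_(i in O) (Km
    i).2)%N.
split=> [|omega beta sigma w0 s0].
  apply: prodr_gt0 => i _; rewrite mulr_gt0 ?(hKm i).1// exprn_gt0//.
  by have := cl0 i; lra.
have N0 := scaled_sqnorm_ge0 beta sigma.
rewrite -prodr_const -prodrXr -!big_split/=; apply: ler_prod => i iO.
rewrite inE in iO.
have t0 : a i <= a i + b i * omega by rewrite lerDl mulr_ge0 ?(ltW w0)//; lra.
apply/andP; split.
  by rewrite /outlier_factor !mulr_ge0 ?invr_ge0 ?(ltW s0) ?(ltW (f_gt0 _)).
have -> : outlier_factor omega i beta sigma =
  sigma^-1 * f ((a i + b i * omega) / sigma - (-1) ^+ s i * (lin i beta / sigma))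
    / f (a i + b i * omega).
  rewrite /outlier_factor /response f_sign; congr (_ * _ / _).
  rewrite -(f_sign (s i)); congr f.
  by rewrite mulrA mulrBr mulrA -signr_addb addbb mul1r mulrBl mulrA.
rewrite ler_pdivrMr//.
apply: (le_trans ((hKm i).2 _ _ _ t0 s0)); rewrite ler_wpM2r ?(ltW (f_gt0 _))//.
rewrite normrMsign.
set w := potter_weight _ _ _ _.
have w00 : 0 <= w := potter_weight_ge0 _ _ _ _.
have -> : (Km i).1 * (1 + c_lin i) ^+ (Km i).2 * w * (1 + scaled_sqnorm beta sigma)
    ^+ (Km i).2
  = (Km i).1 * w * ((1 + c_lin i) * (1 + scaled_sqnorm beta sigma)) ^+ (Km i).2.
  by rewrite exprMn; ring.
rewrite ler_wpM2l ?mulr_ge0 ?(ltW (hKm i).1)//.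
apply: lerXn2r; rewrite ?nnegrE ?mulr_ge0 ?addr_ge0//.
have := lin_le i beta s0; have := cl0 i; nra.
Qed.

Lemma inlier_likelihood_bound : exists2 C : R, 0 < C &
  forall z beta sigma, 0 < sigma ->
    likelihood f x z (~: O)%SET beta sigma <= C * sigma ^- #|~: O|%SET.
Proof.
have [C C0 fC] := error_bounded fE; exists (C ^+ #|~: O|%SET).
  by rewrite exprn_gt0.
move=> z beta sigma s0; rewrite /likelihood -exprVn -exprMn -prodr_const.
apply: ler_prod => i _; rewrite mulr_ge0 ?invr_ge0 ?(ltW s0) ?(ltW (f_gt0 _))//=.
by rewrite mulrC ler_wpM2r// invr_ge0 ltW.
Qed.

End likelihood_ratio.

(** * The dominating function *)

Section domination.
Variables (R : realType) (n p : nat) (c : tail_case) (alpha : R) (f : R -> R).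
Variables (x : 'I_n -> 'cV[R]_p) (s : 'I_n -> bool) (a b : 'I_n -> R).
Variables (prior : 'cV[R]_p -> R -> R) (q : R -> R).
Hypotheses (n_gt0 : (0 < n)%N) (alpha_gt0 : 0 < alpha).
Hypotheses (fE : error_density c alpha f).
Hypotheses (a_gt0 : forall i, 0 < a i) (b_cases : forall i, b i = 0 \/ 1 <= b i).
Hypothesis few_outliers : match c with
  | RegularlyVarying => alpha * #|outliers b|%:R < (#|~: outliers b|%SET)%:R :> R
  | LogRegularlyVarying => (#|outliers b| <= #|~: outliers b|%SET)%N
  end.
Hypothesis priorE : forall beta sigma, 0 < sigma ->
  prior beta sigma = mvnormal_pdf 0 (sigma ^+ 2)%:M beta * q sigma.
Hypothesis q_ge0 : forall sigma, 0 < sigma -> 0 <= q sigma.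
Local Notation O := (outliers b).
Local Notation y := (response s a b).
Implicit Types (beta : 'cV[R]_p) (sigma omega : R).

Lemma mvnormal_pdfE beta sigma : 0 < sigma ->
  mvnormal_pdf 0 (sigma ^+ 2)%:M beta =
  Num.sqrt (2 * pi) ^- p * sigma ^- p * expR (- scaled_sqnorm beta sigma / 2).
Proof.
move=> s0; rewrite /mvnormal_pdf subr0 det_scalar invmx_scalar; congr (_ * expR (-
    _ / _)).
  have A0 : 0 <= 2 * pi * sigma ^+ 2 by rewrite mulr_ge0 ?sqr_ge0// mulr_ge0 ?pi_ge0.
  rewrite -exprMn -{1}(sqr_sqrtr A0) exprAC sqrtr_sqr ger0_norm ?exprn_ge0 ?sqrtr_ge0//.
  by rewrite sqrtrM ?mulr_ge0 ?pi_ge0// sqrtr_sqr gtr0_norm// exprMn invfM.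
by rewrite mul_mx_scalar -scalemxAl mxE mulrC.
Qed.

Lemma prior_bound (m : nat) : exists2 K : R, 0 < K &
  forall beta sigma, 0 < sigma ->
    prior beta sigma * (1 + scaled_sqnorm beta sigma) ^+ m <=
    K * q sigma * \prod_(i < p) normal_pdf 0 (Num.sqrt 2 * sigma) (beta i ord0).
Proof.
(* [4^-1] is half of the Gaussian coefficient 1/2, and [Num.sqrt 2 ^+ p] below is the ratio of the
   two normalizing constants. *)
have q0 : 0 < 4^-1 :> R by rewrite invr_gt0.
have [K K0 hK] := expr_le_expR m q0; exists (K * Num.sqrt 2 ^+ p).
  by rewrite mulr_gt0// exprn_gt0// sqrtr_gt0.
move=> beta sigma s0; have N0 := scaled_sqnorm_ge0 beta sigma.
have sq2 : 0 < Num.sqrt 2 :> R by rewrite sqrtr_gt0.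
rewrite priorE// mvnormal_pdfE// prod_normal_pdf ?mulr_gt0//.
have -> : (beta^T *m beta) ord0 ord0 / (2 * (Num.sqrt 2 * sigma) ^+ 2) =
    4^-1 * scaled_sqnorm beta sigma.
  rewrite /scaled_sqnorm exprMn sqr_sqrtr//; field.
  by rewrite gt_eqF.
rewrite exprMn invfM.
set A := Num.sqrt (2 * pi) ^- p.
have A0 : 0 <= A by rewrite invr_ge0 exprn_ge0 ?sqrtr_ge0.
have B0 : 0 <= sigma ^- p by rewrite invr_ge0 exprn_ge0 ?(ltW s0).
set N := scaled_sqnorm beta sigma in N0 *.
have -> : expR (- N / 2) = expR (- (4^-1 * N)) * expR (- (4^-1 * N)).
  by rewrite -expRD; congr expR; field.
have -> : A * sigma ^- p * (expR (- (4^-1 * N)) * expR (- (4^-1 * N))) * q sigma *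
    (1 + N) ^+ m
  = A * sigma ^- p * q sigma * expR (- (4^-1 * N)) * (expR (- (4^-1 * N)) * (1 + N)
      ^+ m) by ring.
have -> : K * Num.sqrt 2 ^+ p * q sigma *
    (A * (Num.sqrt 2 ^- p * sigma ^- p) * expR (- (4^-1 * N))) =
  A * sigma ^- p * q sigma * expR (- (4^-1 * N)) * K.
  have : Num.sqrt 2 ^+ p != 0 :> R by rewrite gt_eqF// exprn_gt0.
  by move: (Num.sqrt 2 ^+ p) (sigma ^- p) => z t z0; field.
apply: ler_wpM2l; first by rewrite !mulr_ge0 ?expR_ge0 ?q_ge0.
by rewrite expRN ler_pdivrMl ?expR_gt0// mulrC; exact: hK.
Qed.

Lemma weight_exponents : exists e r1 r2 : R, [/\ 0 < e, 0 <= r1, 0 <= r2 &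
  forall sigma, 0 < sigma ->
    potter_weight c alpha e sigma ^+ #|O| * sigma ^- #|~: O|%SET <=
    sigma `^ (- r1) + sigma `^ (- r2)].
Proof.
move: few_outliers; case: (c) => /= few.
  (* A single power occurs here; the exponent 0 adds a harmless 1 so that both cases share one
     form. *)
  exists 1, (#|~: O|%SET%:R - alpha * #|O|%:R), 0; split => //; first lra.
  move=> sigma s0.
  rewrite -powR_mulrn ?powR_ge0// -powRrM -powR_invn ?(ltW s0)//.
  rewrite -powRD; last by rewrite (gt_eqF s0) implybT.
  by rewrite opprB ler_wpDr ?powR_ge0.
have nE : (#|O| + #|~: O|%SET = n)%N by rewrite cardsC card_ord.
have OC0 : (0 < #|~: O|%SET)%N.
  by rewrite lt0n; apply: contraTN few => /eqP h; move: nE; rewrite -ltnNge h addn0 => ->.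
(* With [e = 1 / n] the outlier weights multiply to at most [1 + sigma]. Distributing this over the
   inlier power gives the two exponents; the predecessor is genuine because there is at least one
   inlier. *)
exists (n%:R^-1), (#|~: O|%SET%:R), (#|~: O|%SET.-1%:R); split => // [|sigma s0].
  by rewrite invr_gt0 ltr0n.
have s1 : 0 < 1 + sigma by lra.
rewrite !powR_invn ?(ltW s0)//.
apply: (@le_trans _ _ ((1 + sigma) * sigma ^- #|~: O|%SET)).
  rewrite ler_wpM2r ?invr_ge0 ?exprn_ge0 ?(ltW s0)//.
  rewrite -powR_mulrn ?powR_ge0// -powRrM.
  rewrite -[leRHS](powRr1 (ltW s1)); apply: ler_powR; first lra.
  by rewrite ler_pdivrMl ?ltr0n// mulr1 ler_nat -[leqRHS]nE leq_addr.
rewrite mulrDl mul1r lerD2l; case: #|~: O|%SET OC0 => // k _ /=.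
by rewrite exprS invfM mulrA divff ?mul1r// gt_eqF.
Qed.

(* Half of the Gaussian exponent pays for the polynomial in [|beta| / sigma],
   whence the standard deviation [sqrt 2 * sigma]. *)
Definition dominating (K r1 r2 : R) beta sigma : R :=
  K * (q sigma * (sigma `^ (- r1) + sigma `^ (- r2))) *
  \prod_(i < p) normal_pdf 0 (Num.sqrt 2 * sigma) (beta i ord0).

Lemma full_joint_le_dominating : exists K r1 r2 : R, [/\ 0 < K, 0 <= r1, 0 <= r2 &
  forall omega beta sigma, 0 < omega -> 0 < sigma ->
    full_joint f prior x (y omega) beta sigma / \prod_(i in O) f (y omega i)
    <= dominating K r1 r2 beta sigma].
Proof.
have [e [r1 [r2 [e0 r10 r20 hr]]]] := weight_exponents.
have [K1 [m [K10 h1]]] := outlier_factors_bound x s b alpha_gt0 fE a_gt0 e0.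
have [K2 K20 h2] := inlier_likelihood_bound x b fE.
have [K3 K30 h3] := prior_bound m.
exists (K1 * K2 * K3), r1, r2; split; rewrite ?mulr_gt0// => omega beta sigma w0 s0.
have f0 z : 0 <= f z by exact/ltW/(error_gt0 fE).
have prior0 : 0 <= prior beta sigma.
  rewrite priorE// mulr_ge0 ?q_ge0// mvnormal_pdfE//.
  by rewrite !mulr_ge0 ?expR_ge0 ?invr_ge0 ?exprn_ge0 ?sqrtr_ge0 ?(ltW s0).
rewrite full_jointE//.
have w00 : 0 <= potter_weight c alpha e sigma := potter_weight_ge0 _ _ _ _.
apply: (@le_trans _ _ (prior beta sigma *
    (K1 * potter_weight c alpha e sigma ^+ #|O| * (1 + scaled_sqnorm beta sigma) ^+ m)
    * (K2 * sigma ^- #|~: O|%SET))).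
  apply: ler_pM.
  - rewrite mulr_ge0// prodr_ge0// => i _.
    by rewrite /outlier_factor !mulr_ge0 ?invr_ge0 ?(ltW s0).
  - by rewrite /likelihood prodr_ge0// => i _; rewrite mulr_ge0 ?invr_ge0 ?(ltW s0).
  - by rewrite ler_wpM2l//; exact: h1.
  - exact: h2.
rewrite [leLHS](_ : _ = K1 * K2 *
    (potter_weight c alpha e sigma ^+ #|O| * sigma ^- #|~: O|%SET) *
    (prior beta sigma * (1 + scaled_sqnorm beta sigma) ^+ m)); last by ring.
rewrite /dominating.
set P := \prod_(i < p) _.
rewrite [leRHS](_ : _ = K1 * K2 * (sigma `^ (- r1) + sigma `^ (- r2)) * (K3 * q
    sigma * P)); last by ring.
have N0 := scaled_sqnorm_ge0 beta sigma.
apply: ler_pM; rewrite ?mulr_ge0 ?exprn_ge0 ?invr_ge0 ?exprn_ge0 ?addr_ge0 ?(ltW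
    s0) ?(ltW K10) ?(ltW K20)//.
- by rewrite ler_wpM2l ?mulr_ge0 ?(ltW K10) ?(ltW K20)//; exact: hr.
- exact: h3.
Qed.

End domination.

(** * Dominated convergence along a real parameter *)

Section dominated_convergence_pinfty.
Context d (T : measurableType d) (R : realType) (mu : {measure set T -> \bar R}).
Variables (D : set T) (F : R -> T -> R) (G H : T -> R).
Hypotheses (mD : measurable D) (mF : forall u, measurable_fun D (F u)).
Hypotheses (mG : measurable_fun D G) (iH : mu.-integrable D (EFin \o H)).
Hypothesis FG : forall z, D z -> F u z @[u --> +oo] --> G z.
Hypothesis FH : forall u z, 0 < u -> D z -> `|F u z| <= H z.

Lemma dominated_convergence_pinfty : mu.-integrable D (EFin \o G) /\
  (\int[mu]_(z in D) (F u z)%:E @[u --> +oo%R] --> \int[mu]_(z in D) (G z)%:E)%E.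
Proof.
have main (u : R^nat) : u n @[n --> \oo] --> +oo -> mu.-integrable D (EFin \o G) /\
    (\int[mu]_(z in D) (F (u n) z)%:E @[n --> \oo] --> \int[mu]_(z in D) (G z)%:E)%E.
  (* The domination is available only for positive parameters; replacing the other terms by 1 alters
     the sequence at finitely many places. *)
  move=> uoo; pose v n : R := if 0 < u n then u n else 1.
  have v0 n : 0 < v n by rewrite /v; case: ifP.
  have uv : \forall n \near \oo, u n = v n.
    have /cvgryPgt/(_ 0) := uoo; apply: filterS => n un0.
    by rewrite /v un0.
  have voo : v n @[n --> \oo] --> +oo.
    by apply: cvg_trans uoo; apply: near_eq_cvg; apply: filterS uv.
  have mEF n : measurable_fun D (EFin \o F (v n)) by exact/measurable_EFinP.
  have mEG : measurable_fun D (EFin \o G) by exact/measurable_EFinP.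
  have [|//||iG _ cv] := @dominated_convergence _ _ _ mu D mD
    (fun n => EFin \o F (v n)) (EFin \o G) (EFin \o H) mEF mEG.
  - apply: aeW => z Dz; apply: cvg_EFin; first exact: nearW.
    exact: (cvg_comp _ _ voo (FG Dz)).
  - by apply: aeW => z Dz n; rewrite /= lee_fin; exact: FH.
  split => //; apply: cvg_trans cv; apply: near_eq_cvg.
  by apply: filterS uv => n ->.
split; first by have [] := main (fun n => n%:R) cvgr_idn.
by apply/cvge_pinftyP => u /main[].
Qed.

End dominated_convergence_pinfty.

(** * Measurability and integrability on the parameter space *)

Section measurability.
Variables (R : realType) (p : nat).
Local Notation mu := (@lebesgue_measure R).
Local Notation T := ('cV[R]_p * measurableTypeR R)%type.
Local Notation Par := (@parameters R p : set T).
Implicit Types (beta : 'cV[R]_p) (sigma : R).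

Lemma measurable_scale (g : R -> R) :
  measurable_fun (`]0, +oo[%classic : set R) g ->
  measurable_fun Par (fun bs => g bs.2).
Proof.
move=> mg; apply: (measurable_comp (F := `]0, +oo[%classic : set R)).
- exact: measurable_itv.
- by move=> _ [bs /= bs0 <-]; rewrite /= in_itv/= andbT.
- exact: mg.
- by apply: (measurable_funTS (D := Par)); exact: measurable_snd.
Qed.

Lemma measurable_scaleV : measurable_fun Par (fun bs => (bs.2 : R)^-1).
Proof.
by apply: (measurable_scale (g := fun t : R => t^-1)); exact: measurable_inv_gt0.
Qed.

Lemma measurable_coord i : measurable_fun Par (fun bs => bs.1 i ord0).
Proof.
apply: measurable_funTS; apply: (measurableT_comp (f := fun b : 'cV[R]_p => b i
    ord0)) => //.
exact: measurable_mx_coord.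
Qed.

Lemma measurable_linear_form (v : 'cV[R]_p) :
  measurable_fun Par (fun bs => (v^T *m bs.1) ord0 ord0).
Proof.
rewrite (_ : (fun _ => _) = fun bs : T => \sum_j v^T ord0 j * bs.1 j ord0).
  by apply: measurable_sum => j; apply: measurable_funM => //; exact: measurable_coord.
by apply/funext => bs; rewrite mxE.
Qed.

Lemma measurable_scaled_sqnorm :
  measurable_fun Par (fun bs => scaled_sqnorm bs.1 bs.2).
Proof.
apply: measurable_funM.
  rewrite (_ : (fun _ => _) = fun bs : T => \sum_j bs.1 j ord0 * bs.1 j ord0).
    by apply: measurable_sum => j; apply: measurable_funM; exact: measurable_coord.
  by apply/funext => bs; rewrite mxE; apply: eq_bigr => j _; rewrite mxE.
rewrite (_ : (fun _ => _) = fun bs : T => ((bs.2 : R)^-1) ^+ 2).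
  by apply: measurable_funX; exact: measurable_scaleV.
by apply/funext => bs; rewrite exprVn.
Qed.

Lemma measurable_likelihood n (f : R -> R) (x : 'I_n -> 'cV[R]_p) y I :
  measurable_fun setT f ->
  measurable_fun Par (fun bs => likelihood f x y I bs.1 bs.2).
Proof.
move=> mf; rewrite /likelihood.
under eq_fun do rewrite -big_enum/=.
apply: measurable_prod => i _; apply: measurable_funM; first exact: measurable_scaleV.
apply: (measurableT_comp mf); apply: measurable_funM; last exact: measurable_scaleV.
by apply: measurable_funB => //; exact: measurable_linear_form.
Qed.

Variables (prior : 'cV[R]_p -> R -> R) (q : R -> R).
Hypothesis priorE : forall beta sigma, 0 < sigma ->
  prior beta sigma = mvnormal_pdf 0 (sigma ^+ 2)%:M beta * q sigma.
Hypothesis mq : measurable_fun (`]0, +oo[%classic : set R) q.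
Hypothesis q_ge0 : forall sigma, 0 < sigma -> 0 <= q sigma.
Hypothesis q_moment : forall r, 0 <= r ->
  (\int[mu]_(s in `]0%R, +oo[) (q s * s `^ (- r))%:E < +oo)%E.

Lemma measurable_gaussian (k l : R) :
  measurable_fun Par (fun bs => k * bs.2 ^- p * expR (l * scaled_sqnorm bs.1 bs.2)).
Proof.
apply: measurable_funM.
  apply: measurable_funM => //.
  rewrite (_ : (fun _ => _) = fun bs : T => ((bs.2 : R)^-1) ^+ p).
    by apply: measurable_funX; exact: measurable_scaleV.
  by apply/funext => bs; rewrite exprVn.
apply: measurableT_comp; first exact: measurable_expR.
by apply: measurable_funM => //; exact: measurable_scaled_sqnorm.
Qed.

Lemma measurable_prior : measurable_fun Par (fun bs => prior bs.1 bs.2).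
Proof.
apply: (eq_measurable_fun (fun bs : T =>
  Num.sqrt (2 * pi) ^- p * (bs.2 : R) ^- p * expR (- 2^-1 * scaled_sqnorm bs.1
      bs.2) * q bs.2)).
  by move=> bs; rewrite inE => bs0; rewrite priorE// mvnormal_pdfE// !mulNr (mulrC 2^-1).
apply: measurable_funM; last exact: measurable_scale.
exact: measurable_gaussian.
Qed.

Lemma measurable_dominating K r1 r2 :
  measurable_fun Par (fun bs => dominating q K r1 r2 bs.1 bs.2).
Proof.
apply: measurable_funM.
  apply: measurable_funM => //; apply: measurable_funM; first exact: measurable_scale.
  by apply: measurable_funD; apply: (measurable_scale (g := fun t => t `^ (- _)));
    apply: measurable_funTS; exact: measurable_powR.
apply: (eq_measurable_fun (fun bs : T => (Num.sqrt (2 * pi) ^- p * Num.sqrt 2 ^- p) *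
  (bs.2 : R) ^- p * expR (- 4^-1 * scaled_sqnorm bs.1 bs.2))).
  move=> bs; rewrite inE => bs0; rewrite prod_normal_pdf ?mulr_gt0 ?sqrtr_gt0//.
  rewrite [in RHS]exprMn invfM -!mulrA; do 3 congr (_ * _); congr expR.
  rewrite exprMn sqr_sqrtr// /scaled_sqnorm; field.
  by rewrite gt_eqF.
exact: measurable_gaussian.
Qed.

(** Integrating in [beta] first, for fixed [sigma], the Gaussian factor contributes exactly 1, and
    what remains is [K] times the sum of two negative moments of the scale. *)
Lemma integrable_dominating K r1 r2 : 0 <= K -> 0 <= r1 -> 0 <= r2 ->
  (@vec_lebesgue R p \x mu)%E.-integrable Par
    (EFin \o (fun bs => dominating q K r1 r2 bs.1 bs.2)).
Proof.
move=> K0 r10 r20; have mED : measurable_fun Par (EFin \o (fun bs => dominating q K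
    r1 r2 bs.1 bs.2)).
  by apply/measurable_EFinP; exact: measurable_dominating.
apply/integrableP; split => //.
pose w sigma := K * (q sigma * (sigma `^ (- r1) + sigma `^ (- r2))).
have w0 sigma : 0 < sigma -> 0 <= w sigma.
  by move=> s0; rewrite /w !mulr_ge0 ?addr_ge0 ?powR_ge0 ?q_ge0.
have D0 beta sigma : 0 < sigma -> 0 <= dominating q K r1 r2 beta sigma.
  move=> s0; apply: mulr_ge0; first exact: w0.
  by apply: prodr_ge0 => i _; exact: normal_pdf_ge0.
rewrite (eq_integral (EFin \o (fun bs : T => dominating q K r1 r2 bs.1 bs.2)));
    last first.
  by move=> bs; rewrite inE => bs0 /=; rewrite ger0_norm// D0.
rewrite integral_mkcond fubini_tonelli2; last 2 first.
- exact: (measurable_restrictT _ (@measurable_parameters R p)).1 mED.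
- by apply: erestrict_ge0 => bs bs0; rewrite lee_fin; exact: D0.
rewrite /fubini_G.
set I := (X in (X < _)%E).
have -> : I = (\int[mu]_(sigma in `]0%R, +oo[) (w sigma)%:E)%E.
  rewrite /I [RHS]integral_mkcond; apply: eq_integral => sigma _.
  rewrite [RHS]patchE; case: ifPn => [|].
    rewrite inE/= in_itv/= andbT => s0.
    rewrite (eq_integral (fun beta => (w sigma)%:E *
      (\prod_(i < p) normal_pdf 0 (Num.sqrt 2 * sigma) (beta i ord0))%:E)%E).
      rewrite ge0_integralZl_EFin ?w0//.
      + by rewrite integral_gaussian_vec ?mule1// gt_eqF// mulr_gt0// sqrtr_gt0.
      + by move=> beta _; rewrite lee_fin prodr_ge0// => i _; exact: normal_pdf_ge0.
      + apply/measurable_EFinP; apply: measurable_prod => i _.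
        apply: measurableT_comp; first exact: measurable_normal_pdf.
        exact: measurable_mx_coord.
    by move=> beta _; rewrite patchE mem_set.
  rewrite notin_setE/= in_itv/= andbT => s0.
  apply: integral0_eq => beta _; rewrite patchE memNset//.
rewrite (eq_integral (fun sigma : measurableTypeR R => K%:E * ((q sigma * sigma `^
    (- r1))%:E +
   (q sigma * sigma `^ (- r2))%:E))%E); last first.
  by move=> sigma _; rewrite -EFinD -EFinM -mulrDr.
have mqr r : measurable_fun (`]0, +oo[%classic : set (measurableTypeR R))
    (fun sigma => (q sigma * sigma `^ (- r))%:E).
  apply/measurable_EFinP; apply: measurable_funM => //.
  by apply: measurable_funTS; exact: measurable_powR.
have qr0 r sigma : (`]0, +oo[%classic : set R) sigma -> (0 <= (q sigma * sigma `^
    (- r))%:E)%E.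
  by rewrite /= in_itv/= andbT => s0; rewrite lee_fin mulr_ge0 ?powR_ge0 ?q_ge0.
rewrite ge0_integralZl_EFin//; last 2 first.
- by move=> sigma s0; rewrite adde_ge0// qr0.
- exact: emeasurable_funD.
rewrite ge0_integralD//; [|exact: qr0|exact: qr0].
by rewrite lte_mul_pinfty ?lee_fin// lte_add_pinfty// q_moment.
Qed.

End measurability.

(** * Posterior distributions *)

Section posterior_distribution.
Variables (R : realType) (p : nat).
Local Notation mu := (@lebesgue_measure R).
Local Notation Lam := (@vec_lebesgue R p \x mu)%E.
Local Notation T := ('cV[R]_p * measurableTypeR R)%type.
Local Notation Par := (@parameters R p : set T).
Implicit Types (K L : 'cV[R]_p -> R -> R) (beta : 'cV[R]_p) (sigma : R).

(** Otherwise the standard Gaussian density would integrate to 0. *)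
Lemma vec_lebesgueT_gt0 : (0 < @vec_lebesgue R p setT)%E.
Proof.
rewrite lt0e measure_ge0 andbT; apply/eqP => h.
have := @integral_gaussian_vec R p 1 (oner_neq0 _).
rewrite null_set_integral//; first by move=> /esym/eqP; rewrite onee_eq0.
apply/measurable_EFinP; apply: measurable_prod => i _.
apply: measurableT_comp; first exact: measurable_normal_pdf.
exact: measurable_mx_coord.
Qed.

(** [K] may vanish, but only where [q] does. A zero marginal would make the product of R^p with the
    set where [q] is nonzero a null set; as R^p has positive measure, that set would itself be null,
    against the positive integral of [q]. *)
Lemma marginal_gt0 (q : R -> R) K L :
  measurable_fun (`]0, +oo[%classic : set R) q ->
  (forall sigma, 0 < sigma -> 0 <= q sigma) ->
  (0 < \int[mu]_(s in `]0%R, +oo[) (q s)%:E)%E ->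
  measurable_fun Par (fun bs => K bs.1 bs.2) ->
  (forall beta sigma, 0 < sigma -> 0 < L beta sigma) ->
  (forall beta sigma, 0 < sigma -> K beta sigma = q sigma * L beta sigma) ->
  (0 < marginal K)%E.
Proof.
move=> mq q0 iq mK L0 KE.
have K0 beta sigma : 0 < sigma -> 0 <= K beta sigma.
  by move=> s0; rewrite KE// mulr_ge0 ?q0// ltW// L0.
rewrite marginalE// lt0e integral_ge0 ?andbT; last first.
  by move=> bs bs0; rewrite lee_fin K0.
apply/eqP => h.
have mEK : measurable_fun Par (EFin \o (fun bs => K bs.1 bs.2)) by exact/measurable_EFinP.
have : ae_eq Lam Par (EFin \o (fun bs => K bs.1 bs.2)) (cst 0%E).
  apply/(ae_eq_integral_abs Lam) => //; first exact: measurable_parameters.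
  by rewrite -[RHS]h; apply: eq_integral => bs; rewrite inE => bs0; rewrite
      gee0_abs ?lee_fin ?K0.
move=> [N [mN N0 subN]].
pose S : set (measurableTypeR R) := `]0, +oo[%classic `&` q @^-1` [set~ 0].
have mS : measurable S.
  by apply: mq; [exact: measurable_itv|apply: measurableC; exact: measurable_set1].
have mT : measurable ([set: 'cV[R]_p] `*` S) by exact: measurableX.
have : (Lam ([set: 'cV[R]_p] `*` S) <= Lam N)%E.
  apply: le_measure; rewrite ?inE//; apply: subset_trans subN => -[beta sigma] /= [_].
  rewrite /S/= in_itv/= andbT => -[s0 qs0] /(_ s0)[]; rewrite KE// => /eqP.
  by rewrite mulf_eq0 (gt_eqF (L0 _ _ s0)) orbF => /eqP.
rewrite N0 product_measure1E// => TS.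
have S0 : mu S = 0%E.
  apply/eqP; rewrite eq_le measure_ge0 andbT leNgt; apply/negP => S0.
  by move: TS; rewrite leNgt mule_gt0// vec_lebesgueT_gt0.
move: iq; rewrite (_ : (\int[mu]_(s in _) _)%E = 0%E) ?ltxx//.
rewrite (ae_eq_integral (cst 0%E)) ?integral0//; first exact/measurable_EFinP.
exists S; split => //= sigma /= hs; split; first by apply: contrapT => s0; apply: hs.
by move=> qs; apply: hs => _; rewrite qs.
Qed.

(** [has_density] speaks of sets only; the second clause extends it to measurable functions of
    either sign, as the test functions of weak convergence require. *)
Lemma posterior_probability K :
  measurable_fun Par (fun bs => K bs.1 bs.2) ->
  (forall beta sigma, 0 < sigma -> 0 <= K beta sigma) ->
  (0 < marginal K < +oo)%E ->
  exists2 P : probability ('cV[R]_p * R)%type R,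
    has_density P (posterior K) &
    forall h : 'cV[R]_p * R -> R, measurable_fun Par h ->
    (\int[P]_(bs in @parameters R p) (h bs)%:E =
     \int[Lam]_(bs in Par) (h bs * posterior K bs.1 bs.2)%:E)%E.
Proof.
move=> mK K0 /andP[mg0 mgoo].
have mgfin : marginal K \is a fin_num by rewrite ge0_fin_numE// ltW.
have fmg0 : 0 < fine (marginal K) by rewrite fine_gt0// mg0.
have mPar := @measurable_parameters R p.
have mpost : measurable_fun Par (fun bs => posterior K bs.1 bs.2).
  exact: measurable_funM.
have post0 beta sigma : 0 < sigma -> 0 <= posterior K beta sigma.
  by move=> s0; rewrite divr_ge0 ?K0// ltW.
pose W : T -> R := (fun bs => posterior K bs.1 bs.2) \_ Par.
have mW : measurable_fun setT W by exact: (measurable_restrictT _ mPar).1 mpost.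
have W0 bs : 0 <= W bs.
  by rewrite /W patchE; case: ifPn => // /[!inE]; exact: post0.
have [nu nuE] := density_measure Lam mW W0.
(* [T] and ['cV[R]_p * R] have the same measurable sets but different displays. *)
pose idT (bs : T) : 'cV[R]_p * R := bs.
have mid : measurable_fun setT idT.
  by apply/measurable_fun_pairP; split; [exact: measurable_fst|exact: measurable_snd].
pose pf := measure_function_pushforward__canonical__measure_function_Measure nu mid.
have int_patch (k : T -> R) A : measurable A ->
    (\int[Lam]_(bs in A) (k bs * W bs)%:E =
     \int[Lam]_(bs in Par) (k bs * posterior K bs.1 bs.2 * \1_A bs)%:E)%E.
  move=> mA; rewrite [LHS]integral_mkcond [RHS]integral_mkcond; apply: eq_integral
      => bs _.
  rewrite !patchE /W patchE indicE; case: (bs \in A); case: (bs \in Par) => //=.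
  - by rewrite mulr1.
  - by rewrite mulr0.
  - by rewrite mulr0.
have pfE A : measurable A ->
    pf A = marginal (fun beta sigma => posterior K beta sigma * \1_A (beta, sigma)).
  move=> mA; rewrite /pf/= /pushforward nuE /density_content.
  have mA' : measurable (A : set T) by have := mid measurableT A mA; rewrite setTI.
  rewrite marginalE; last 2 first.
  - apply: measurable_funM => //; apply: (eq_measurable_fun (\1_A : T -> R)) => [[]//|].
    by apply: measurable_funTS; exact: measurable_indic.
  - by move=> beta sigma s0; rewrite mulr_ge0 ?post0// indicE.
  under eq_integral do rewrite -[W _]mul1r.
  by rewrite (int_patch (cst 1))//; apply: eq_integral => -[beta sigma] _; rewrite mul1r.
have pf1 : pf setT = 1%E.
  rewrite pfE// marginalE.
  - rewrite (eq_integral (fun bs : T => (fine (marginal K))^-1%:E * (K bs.1 bs.2)%:E)%E).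
      rewrite ge0_integralZl_EFin ?invr_ge0 ?(ltW fmg0)//.
      + by rewrite -marginalE// -(fineK mgfin) -EFinM mulVf ?gt_eqF.
      + by move=> bs bs0; rewrite lee_fin K0.
      + exact/measurable_EFinP.
    by move=> bs _; rewrite indicT mulr1 /posterior mulrC EFinM.
  - by under eq_fun do rewrite indicT mulr1.
  - by move=> beta sigma s0; rewrite indicT mulr1 post0.
pose P : probability ('cV[R]_p * R)%type R :=
  HB.pack (Measure.sort pf) (Measure_isProbability.Build _ _ _ pf pf1).
exists P => [A mA|h mh]; first exact: pfE.
transitivity (\int[nu]_(bs in Par) (h bs)%:E)%E.
  rewrite -[LHS]/(\int[pushforward nu idT]_(bs in @parameters R p) (h bs)%:E)%E.
  have mPar' : measurable (@parameters R p) by exact: mPar.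
  have mEh : measurable_fun (@parameters R p) (EFin \o h).
    by apply/measurable_EFinP; exact: mh.
  rewrite [LHS]integralE [RHS]integralE; congr (_ - _)%E.
    by rewrite ge0_integral_pushforward//; exact: measurable_funepos.
  by rewrite ge0_integral_pushforward//; exact: measurable_funeneg.
rewrite (integral_density (mu := Lam) mW W0)//; last by move=> A mA; rewrite nuE.
by apply: eq_integral => bs bsP; rewrite /W patchE bsP.
Qed.

End posterior_distribution.

(** * The three limits *)

Theorem theorem1 (R : realType) (n p : nat) (hn : (0 < n)%N) (hp : (0 < p)%N)
    (c : tail_case) (alpha : R) (halpha : 0 < alpha) (f : R -> R)
    (prior : 'cV[R]_p -> R -> R)
    (x : 'I_n -> 'cV[R]_p) (s : 'I_n -> bool) (a b : 'I_n -> R)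
    (ha : forall i, 0 < a i) (hb : forall i, b i = 0 \/ 1 <= b i)
    (A1 : error_density c alpha f)
    (A2 : conjugate_prior prior)
    (A3 : match c with
          | RegularlyVarying =>
              alpha * #|outliers b|%:R < (#|~: outliers b|%SET)%:R :> R
          | LogRegularlyVarying => (#|outliers b| <= #|~: outliers b|%SET)%N
          end) :
  let O := outliers b in
  let y := response s a b in
  let k := fun omega => full_joint f prior x (y omega) in
  (* the y_i with i outside O do not depend on omega *)
  let kOc := robust_joint c alpha f prior x (y 0) O in
  [/\ (forall omega, 0 < omega -> (0 < marginal (k omega) < +oo)%E)
        /\ (0 < marginal kOc < +oo)%E,
      (marginal (k omega) * ((\prod_(i in O) f (y omega i))^-1)%:E)%E
        @[omega --> +oo] --> marginal kOc,
      forall (beta : 'cV[R]_p) (sigma : R), 0 < sigma ->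
        posterior (k omega) beta sigma @[omega --> +oo]
          --> posterior kOc beta sigma
    & exists (P : R -> probability ('cV[R]_p * R)%type R)
             (Q : probability ('cV[R]_p * R)%type R),
        [/\ forall omega, 0 < omega -> has_density (P omega) (posterior (k omega)),
            has_density Q (posterior kOc)
          & cvg_in_distribution P Q]].
Proof.
move=> O y k kOc.
case: A2 => shape [scale [q [[sh0 sc0] [mq q0] q_law priorE]]].
pose mu := @lebesgue_measure R.
pose T : measurableType _ := ('cV[R]_p * measurableTypeR R)%type.
pose Par : set T := @parameters R p.
pose Lam := (@vec_lebesgue R p \x mu)%E.
have mPar : measurable Par := @measurable_parameters R p.
have q1 : (\int[mu]_(t in `]0%R, +oo[) (q t)%:E = 1)%E.
  exact: integral_sigma_prior q_law.
have qr r : 0 <= r -> (\int[mu]_(t in `]0%R, +oo[) (q t * t `^ (- r))%:E < +oo)%E.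
  exact: (integral_sigma_prior_powR sh0 sc0 mq q0 q_law).
have f0 z : 0 < f z := error_gt0 A1 z.
have mf : measurable_fun setT f := error_measurable A1.
have normal0 beta sigma : 0 < sigma -> 0 < mvnormal_pdf 0 (sigma ^+ 2)%:M beta.
  move=> s0; rewrite mvnormal_pdfE// !mulr_gt0 ?expR_gt0 ?invr_gt0 ?exprn_gt0//.
  by rewrite sqrtr_gt0 mulr_gt0 ?pi_gt0.
have lik0 z I beta sigma : 0 < sigma -> 0 < likelihood f x z I beta sigma.
  by move=> s0; rewrite prodr_gt0// => i _; rewrite mulr_gt0 ?invr_gt0.
have prior0 beta sigma : 0 < sigma -> 0 <= prior beta sigma.
  by move=> s0; rewrite priorE// mulr_ge0 ?q0// ltW// normal0.
have g0 sigma : 0 < sigma -> 0 < outlier_weight c alpha sigma.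
  by move=> s0; case: (c) => //=; exact: powR_gt0.
have mprior : measurable_fun Par (fun bs => prior bs.1 bs.2).
  exact: measurable_prior priorE mq.
have mk omega : measurable_fun Par (fun bs => k omega bs.1 bs.2).
  by apply: measurable_funM => //; exact: measurable_likelihood.
have mkOc : measurable_fun Par (fun bs => kOc bs.1 bs.2).
  apply: measurable_funM; last exact: measurable_likelihood.
  apply: measurable_funM => //; apply: measurable_funX.
  case: (c) => //=; apply: (measurable_scale (g := fun t => t `^ alpha)).
  by apply: measurable_funTS; exact: measurable_powR.
have k0 omega beta sigma : 0 < sigma -> 0 <= k omega beta sigma.
  by move=> s0; rewrite mulr_ge0 ?prior0// ltW// lik0.
have kOc0 beta sigma : 0 < sigma -> 0 <= kOc beta sigma.
  by move=> s0; rewrite !mulr_ge0 ?prior0 ?exprn_ge0// ltW ?lik0 ?g0.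
have iq0 : (0 < \int[mu]_(t in `]0%R, +oo[) (q t)%:E)%E by rewrite q1.
have marg0 omega : (0 < marginal (k omega))%E.
  apply: (marginal_gt0 (q := q) (L := fun beta sigma =>
    mvnormal_pdf 0 (sigma ^+ 2)%:M beta * likelihood f x (y omega) [set: 'I_n]%SET
        beta sigma)) => //.
  - by move=> beta sigma s0; rewrite mulr_gt0 ?normal0 ?lik0.
  - by move=> beta sigma s0; rewrite /k /full_joint priorE//; ring.
have margOc0 : (0 < marginal kOc)%E.
  apply: (marginal_gt0 (q := q) (L := fun beta sigma =>
    mvnormal_pdf 0 (sigma ^+ 2)%:M beta * (outlier_weight c alpha sigma ^+ #|O| *
    likelihood f x (y 0) (~: O)%SET beta sigma))) => //.
  - move=> beta sigma s0; rewrite mulr_gt0 ?normal0// mulr_gt0 ?lik0//.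
    by rewrite exprn_gt0// g0.
  - by move=> beta sigma s0; rewrite /kOc /robust_joint priorE//; ring.
pose Pf omega := \prod_(i in O) f (y omega i).
have Pf0 omega : 0 < Pf omega by rewrite prodr_gt0.
have [K [r1 [r2 [K0 r10 r20 kD]]]] :=
  full_joint_le_dominating x s hn halpha A1 ha hb A3 priorE q0.
pose D (bs : T) := dominating q K r1 r2 bs.1 bs.2.
have iD : Lam.-integrable Par (EFin \o D).
  by apply: integrable_dominating => //; exact: ltW.
pose F omega (bs : T) := k omega bs.1 bs.2 / Pf omega.
have mF omega : measurable_fun Par (F omega) by exact: measurable_funM.
have F0 omega bs : Par bs -> 0 <= F omega bs.
  by move=> bs0; rewrite divr_ge0 ?k0// ltW.
have FD omega bs : 0 < omega -> Par bs -> F omega bs <= D bs.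
  by move=> w0 bs0; exact: kD.
have FkOc (bs : T) : Par bs -> F omega bs @[omega --> +oo] --> kOc bs.1 bs.2.
  by move=> bs0; apply: cvg_full_joint.
(* One passage to the limit serves twice: [h = 1] gives the marginals of (a), and a bounded
   continuous [h] gives the weak convergence of (c). *)
have cvgF (h : T -> R) (M : R) : measurable_fun Par h ->
    (forall bs, Par bs -> `|h bs| <= M) ->
    [/\ forall omega, 0 < omega -> Lam.-integrable Par (EFin \o (fun bs => h bs * F
        omega bs)),
        Lam.-integrable Par (EFin \o (fun bs => h bs * kOc bs.1 bs.2)) &
    (\int[Lam]_(bs in Par) (h bs * F omega bs)%:E @[omega --> +oo%R] -->
     \int[Lam]_(bs in Par) (h bs * kOc bs.1 bs.2)%:E)%E].
  move=> mh hM.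
  have mhF omega : measurable_fun Par (fun bs => h bs * F omega bs).
    exact: measurable_funM.
  have iMD : Lam.-integrable Par (EFin \o (fun bs => M * D bs)).
    rewrite (_ : _ \o _ = (fun bs => M%:E * (EFin \o D) bs)%E); first exact: integrableZl.
    by apply/funext => bs; rewrite /= EFinM.
  have hFD omega bs : 0 < omega -> Par bs -> `|h bs * F omega bs| <= M * D bs.
    move=> w0 bs0; rewrite normrM (ger0_norm (F0 _ _ bs0)).
    by apply: ler_pM => //; [exact: F0|exact: hM|exact: FD].
  have [|//|] := @dominated_convergence_pinfty _ _ _ Lam Par
    (fun omega bs => h bs * F omega bs) (fun bs => h bs * kOc bs.1 bs.2) (fun bs =>
        M * D bs)
    mPar mhF _ iMD _ hFD.
  - exact: measurable_funM.
  - by move=> bs bs0; apply: cvgMr; exact: FkOc.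
  move=> iG cv; split => // omega w0.
  apply: (le_integrable mPar _ _ iMD).
    exact/measurable_EFinP.
  move=> bs bs0 /=; rewrite lee_fin; apply: le_trans (hFD _ _ w0 bs0) _.
  exact: ler_norm.
have margF omega : (marginal (k omega) * ((Pf omega)^-1)%:E =
    \int[Lam]_(bs in Par) (F omega bs)%:E)%E.
  rewrite marginalE//; last by move=> beta sigma; exact: k0.
  rewrite muleC -ge0_integralZl_EFin ?invr_ge0 ?(ltW (Pf0 _))//.
  - by apply: eq_integral => bs _; rewrite /F -EFinM mulrC.
  - by move=> bs bs0; rewrite lee_fin k0.
  - exact/measurable_EFinP.
have [iF ikOc cvgF1] : [/\ forall omega, 0 < omega -> Lam.-integrable Par (EFin \o
    F omega),
    Lam.-integrable Par (EFin \o (fun bs => kOc bs.1 bs.2)) &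
    (\int[Lam]_(bs in Par) (F omega bs)%:E @[omega --> +oo%R] --> marginal kOc)%E].
  have [||iF ikOc cv] := cvgF (cst 1) 1 => //; first by move=> bs _; rewrite normr1.
  split => [omega w0||].
  - by apply: eq_integrable (iF _ w0) => // bs _; rewrite /= mul1r.
  - by apply: eq_integrable ikOc => // bs _; rewrite /= mul1r.
  rewrite marginalE// [X in _ --> X](_ : _ =
    \int[Lam]_(bs in Par) (cst 1 bs * kOc bs.1 bs.2)%:E)%E; last first.
    by apply: eq_integral => bs _; rewrite /= mul1r.
  apply: cvg_trans cv; apply: near_eq_cvg; apply: nearW => omega.
  by apply: eq_integral => bs _; rewrite /= mul1r.
(* Finiteness of the limiting constant is inherited from the dominating function, through
   integrability of the pointwise limit. *)
have margOcoo : (marginal kOc < +oo)%E.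
  by rewrite marginalE//; exact: integrable_lty ikOc.
have margoo omega : 0 < omega -> (marginal (k omega) < +oo)%E.
  move=> w0; have := integrable_lty mPar (iF _ w0); rewrite -margF.
  by apply: contraTT; rewrite -!leNgt !leye_eq => /eqP ->; rewrite gt0_mulye//
      lte_fin invr_gt0.
have fin omega : 0 < omega -> marginal (k omega) \is a fin_num.
  by move=> w0; rewrite gt0_fin_numE; [exact: margoo|exact: marg0].
have finOc : marginal kOc \is a fin_num by rewrite gt0_fin_numE.
have partA : (marginal (k omega) * ((Pf omega)^-1)%:E @[omega --> +oo%R] -->
    marginal kOc)%E.
  by under eq_fun do rewrite margF.
have fOc0 : fine (marginal kOc) != 0 by rewrite gt_eqF// fine_gt0// margOc0.
have cvgc : Pf omega / fine (marginal (k omega)) @[omega --> +oo] --> (fine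
    (marginal kOc))^-1.
  have : (fine (marginal (k omega) * ((Pf omega)^-1)%:E)%E)^-1 @[omega --> +oo]
      --> (fine (marginal kOc))^-1.
    by apply: cvgV => //; apply: fine_cvg; rewrite fineK.
  apply: cvg_trans; apply: near_eq_cvg; near=> omega.
  have w0 : 0 < omega by near: omega; exact: nbhs_pinfty_gt.
  by rewrite fineM ?fin//= invf_div.
(* The posterior is unchanged when the joint density and its marginal are both divided by
   [Pf omega]; in this form both factors converge. *)
have postE omega bs : posterior (k omega) bs.1 bs.2 =
    F omega bs * (Pf omega / fine (marginal (k omega))).
  by rewrite /posterior /F mulrA divfK// gt_eqF.
split.
- split=> [omega w0|]; apply/andP; split;
    [exact: marg0|exact: margoo|exact: margOc0|exact: margOcoo].
- exact: partA.
- move=> beta sigma s0.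
  have : F omega (beta, sigma) * (Pf omega / fine (marginal (k omega)))
      @[omega --> +oo] --> posterior kOc beta sigma.
    by apply: cvgM cvgc; exact: (@FkOc (beta, sigma) s0).
  by under eq_fun do rewrite -postE.
have [Q dQ intQ] := posterior_probability mkOc kOc0 (introT andP (conj margOc0 margOcoo)).
have /choice[P hP] : forall omega, exists P : probability ('cV[R]_p * R)%type R,
    0 < omega -> has_density P (posterior (k omega)) /\
    forall h : 'cV[R]_p * R -> R, measurable_fun Par h ->
    (\int[P]_(bs in @parameters R p) (h bs)%:E =
     \int[Lam]_(bs in Par) (h bs * posterior (k omega) bs.1 bs.2)%:E)%E.
  (* [Q] is a default value for [omega <= 0], where nothing is claimed and which the limit does not
     see. *)
  move=> omega; have [w0|w0] := ltP 0 omega; last by exists Q.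
  have [P dP intP] := posterior_probability (mk omega) (k0 omega)
    (introT andP (conj (marg0 omega) (margoo _ w0))).
  by exists P.
exists P, Q; split => [omega w0||h ch [M hM]]; [exact: (hP _ w0).1|exact: dQ|].
have mh : measurable_fun Par h := measurable_within_continuous ch.
have [ihF ihk cv] := cvgF h M mh hM.
rewrite intQ//.
have -> : (\int[Lam]_(bs in Par) (h bs * posterior kOc bs.1 bs.2)%:E =
    \int[Lam]_(bs in Par) (h bs * kOc bs.1 bs.2)%:E * ((fine (marginal kOc))^-1)%:E)%E.
  rewrite -integralZr//; apply: eq_integral => bs _.
  by rewrite -EFinM mulrA.
have : ((\int[Lam]_(bs in Par) (h bs * F omega bs)%:E) *
    (Pf omega / fine (marginal (k omega)))%:E @[omega --> +oo%R] -->
    \int[Lam]_(bs in Par) (h bs * kOc bs.1 bs.2)%:E * ((fine (marginal kOc))^-1)%:E)%E.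
  apply: cvgeM => //.
    by apply: mule_def_fin => //; exact: integrable_fin_num.
  by apply: cvg_EFin => //; exact: nearW.
apply: cvg_trans; apply: near_eq_cvg; near=> omega.
have w0 : 0 < omega by near: omega; exact: nbhs_pinfty_gt.
rewrite (hP _ w0).2// -integralZr//; last exact: ihF.
by apply: eq_integral => bs _; rewrite -EFinM postE mulrA.
Unshelve. all: by end_near. Qed.
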